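(* Let $(H,\beta)$ be a Hom-Hopf algebra over a field $K$ with bijective antipode $S$ and with $\beta^2=\mathrm{id}_H$. Let $(A,\alpha)$ be a left $(H,\beta)$-module Hom-algebra with action $\rhd$ and a left $(H,\beta)$-comodule Hom-coalgebra with coaction $\rho(a)=a_{-1}\otimes a_0$. Then the vector space $A\otimes H$ with automorphism $\alpha\otimes\beta$, multiplication $(a\otimes h)(a'\otimes h')=a(h_1\rhd\alpha^{-1}(a'))\otimes\beta^{-1}(h_2)h'$, unit $1_A\otimes1_H$, comultiplication $\Delta(a\otimes h)=a_1\otimes a_{2\,-1}\beta^{-1}(h_1)\otimes\alpha^{-1}(a_{2\,0})\otimes h_2$ and counit $\varepsilon_A\otimes\varepsilon_H$ is a Hom-bialgebra (a Radford biproduct Hom-bialgebra) if and only if $(A,\alpha)$ is a (Hom-)bialgebra in the Hom-Yetter-Drinfeld category ${}_H^H\mathbb{YD}$.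
   Context: All spaces are over a field $K$. Sweedler-type notation: $\Delta(c)=c_1\otimes c_2$, $\Delta(c_1)=c_{11}\otimes c_{12}$, etc., summation understood; $a_{2\,-1}\otimes a_{2\,0}=\rho(a_2)$. Hom-algebra $(A,\mu,1_A,\alpha)$ (abbr. $(A,\alpha)$): a vector space $A$, a linear map $\mu:A\otimes A\to A$, $a\otimes a'\mapsto aa'$, an element $1_A\in A$ and a bijective linear map $\alpha:A\to A$ with $\alpha(aa')=\alpha(a)\alpha(a')$, $\alpha(1_A)=1_A$, $\alpha(a)(a'a'')=(aa')\alpha(a'')$, $a1_A=1_Aa=\alpha(a)$. Hom-coalgebra $(C,\Delta,\varepsilon_C,\beta)$ (abbr. $(C,\beta)$): a vector space $C$, linear maps $\Delta:C\to C\otimes C$, $\varepsilon_C:C\to K$ and a bijective linear map $\beta:C\to C$ with $\Delta(\beta(c))=\beta(c_1)\otimes\beta(c_2)$, $\varepsilon_C\circ\beta=\varepsilon_C$, $\beta(c_1)\otimes c_{21}\otimes c_{22}=c_{11}\otimes c_{12}\otimes\beta(c_2)$, $\varepsilon_C(c_1)c_2=c_1\varepsilon_C(c_2)=\beta(c)$. Hom-bialgebra $(H,\mu,1_H,\Delta,\varepsilon,\beta)$ (abbr. $(H,\beta)$): $(H,\mu,1_H,\beta)$ is a Hom-algebra, $(H,\Delta,\varepsilon,\beta)$ is a Hom-coalgebra, and $\Delta(hh')=h_1h'_1\otimes h_2h'_2$, $\Delta(1_H)=1_H\otimes1_H$, $\varepsilon(hh')=\varepsilon(h)\varepsilon(h')$,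 $\varepsilon(1_H)=1$. A Hom-Hopf algebra $(H,\beta,S)$ is a Hom-bialgebra with a linear map $S:H\to H$ (antipode) such that $S(h_1)h_2=h_1S(h_2)=\varepsilon(h)1_H$ and $S(\beta(h))=\beta(S(h))$. Left $(H,\beta)$-Hom-module $(M,\rhd,\alpha)$ over a Hom-algebra $(H,\beta)$: a vector space $M$, a linear map $\rhd:H\otimes M\to M$ and a bijective linear map $\alpha:M\to M$ with $\alpha(h\rhd m)=\beta(h)\rhd\alpha(m)$, $\beta(h)\rhd(h'\rhd m)=(hh')\rhd\alpha(m)$, $1_H\rhd m=\alpha(m)$. A morphism $f:M\to N$ of left Hom-modules is a linear map with $f(h\rhd_M m)=h\rhd_N f(m)$ and $\alpha_N\circ f=f\circ\alpha_M$. Left $(H,\beta)$-Hom-comodule $(M,\rho,\alpha)$ over a Hom-coalgebra $(H,\beta)$: a vector space $M$, a linear map $\rho:M\to H\otimes M$, $\rho(m)=m_{-1}\otimes m_0$, and a bijective linear map $\alpha:M\to M$ with $\rho(\alpha(m))=\beta(m_{-1})\otimes\alpha(m_0)$, $\beta(m_{-1})\otimes m_{0\,-1}\otimes m_{0\,0}=m_{-1\,1}\otimes m_{-1\,2}\otimes\alpha(m_0)$, $\varepsilon(m_{-1})m_0=\alpha(m)$. A morphism $f:M\to N$ of left Hom-comodules is a linear map with $f(m)_{-1}\otimes f(m)_0=m_{-1}\otimes f(m_0)$ and $\alpha_N\circ f=f\circ\alpha_M$. Let $(H,\beta)$ be a Hom-bialgebra. - $(H,\beta)$-module Hom-algebra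 $(A,\rhd,\alpha)$: $(A,\alpha)$ is a Hom-algebra, $(A,\rhd,\alpha)$ is a left $(H,\beta)$-Hom-module, $\beta^2(h)\rhd(aa')=(h_1\rhd a)(h_2\rhd a')$ and $h\rhd1_A=\varepsilon(h)1_A$. - $(H,\beta)$-comodule Hom-coalgebra $(C,\rho,\alpha)$: $(C,\alpha)$ is a Hom-coalgebra, $(C,\rho,\alpha)$ is a left $(H,\beta)$-Hom-comodule, $\beta^2(c_{-1})\otimes c_{0\,1}\otimes c_{0\,2}=c_{1\,-1}c_{2\,-1}\otimes c_{1\,0}\otimes c_{2\,0}$ and $c_{-1}\varepsilon_C(c_0)=1_H\varepsilon_C(c)$. (Left-left) Hom-Yetter-Drinfeld module over $(H,\beta)$: a quadruple $(M,\rhd_M,\rho^M,\alpha_M)$ such that $(M,\rhd_M,\alpha_M)$ is a left $(H,\beta)$-Hom-module, $(M,\rho^M,\alpha_M)$ is a left $(H,\beta)$-Hom-comodule, and for all $h\in H$, $m\in M$ $$h_1\beta(m_{-1})\otimes(\beta^3(h_2)\rhd_M m_0)=(\beta^2(h_1)\rhd_M m)_{-1}h_2\otimes(\beta^2(h_1)\rhd_M m)_0 .$$ ${}_H^H\mathbb{YD}$ is the category of these, with morphisms the linear maps that are morphisms of both Hom-modules and Hom-comodules. The tensor product $M\otimes N$ has automorphism $\alpha_M\otimes\alpha_N$, action $h\rhd(m\otimes n)=(h_1\rhd_M m)\otimes(h_2\rhd_N n)$ and coaction $m\otimes n\mapsto\beta^{-2}(m_{-1}n_{-1})\otimes m_0\otimes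 n_0$; the unit object is $(K,\mathrm{id}_K)$ with action $h\otimes k\mapsto\varepsilon(h)k$ and coaction $k\mapsto1_H\otimes k$; the braiding is $c_{M,N}(m\otimes n)=(\beta^2(m_{-1})\rhd_N\alpha_N^{-1}(n))\otimes\alpha_M^{-1}(m_0)$. $(A,\alpha)$, with its given Hom-algebra structure, Hom-coalgebra structure, action and coaction, is a (Hom-)bialgebra in ${}_H^H\mathbb{YD}$ if: $(A,\rhd,\rho,\alpha)$ is an object of ${}_H^H\mathbb{YD}$; the multiplication $A\otimes A\to A$, the unit $K\to A$, $k\mapsto k1_A$, the comultiplication $\Delta_A:A\to A\otimes A$ and the counit $\varepsilon_A:A\to K$ are morphisms in ${}_H^H\mathbb{YD}$; and $\Delta_A$, $\varepsilon_A$ are multiplicative and unital with respect to the braided product on $A\otimes A$, i.e. $\Delta_A\circ\mu_A=(\mu_A\otimes\mu_A)\circ(\mathrm{id}_A\otimes c_{A,A}\otimes\mathrm{id}_A)\circ(\Delta_A\otimes\Delta_A)$, $\Delta_A(1_A)=1_A\otimes1_A$, $\varepsilon_A(ab)=\varepsilon_A(a)\varepsilon_A(b)$, $\varepsilon_A(1_A)=1$. *)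

(* Defs.v *)
From HB Require Import structures.
From mathcomp Require Import all_boot all_algebra.
From mathcomp Require Import boolp.

Set Implicit Arguments.
Unset Strict Implicit.
Unset Printing Implicit Defensive.

Import GRing.Theory.
Local Open Scope ring_scope.
Local Open Scope quotient_scope.

Reserved Notation "U ⨂ V" (at level 40, left associativity).
Reserved Notation "u ⊗ v" (at level 40, left associativity).
Reserved Notation "'Σ(' u ⊗ v ':=' t ) E"
  (at level 41, u name, v name, t at level 200, E at level 41, right associativity,
   format "'Σ('  u  ⊗  v  ':='  t ) '/ '  E").

(* Tensor product of two vector spaces: the commutative monoid generated by the
   symbols u ⊗ v (formal sums are sequences of pairs) modulo the congruence
   generated by bilinearity.  The scalars are absorbed by either factor. *)
Section TensorProduct.
Variables (K : fieldType) (U V : lmodType K).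

Inductive tens_rel : seq (U * V) -> seq (U * V) -> Prop :=
| tens_refl s : tens_rel s s
| tens_sym s t : tens_rel s t -> tens_rel t s
| tens_trans s t r : tens_rel s t -> tens_rel t r -> tens_rel s r
| tens_cat s s' t t' :
    tens_rel s s' -> tens_rel t t' -> tens_rel (s ++ t) (s' ++ t')
| tens_catC s t : tens_rel (s ++ t) (t ++ s)
| tens_addl u u' v : tens_rel [:: (u + u', v)] [:: (u, v); (u', v)]
| tens_addr u v v' : tens_rel [:: (u, v + v')] [:: (u, v); (u, v')]
| tens_scale (a : K) u v : tens_rel [:: (a *: u, v)] [:: (u, a *: v)]
| tens_zero v : tens_rel [:: (0, v)] [::].

Definition tens_relb : rel (seq (U * V)) := fun s t => `[< tens_rel s t >].

Fact tens_relb_refl : reflexive tens_relb.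
Proof. by move=> s; apply/asboolP/tens_refl. Qed.

Fact tens_relb_sym : symmetric tens_relb.
Proof. by move=> s t; apply/asboolP/asboolP; apply: tens_sym. Qed.

Fact tens_relb_trans : transitive tens_relb.
Proof.
by move=> t s r /asboolP st /asboolP tr; apply/asboolP; apply: tens_trans st tr.
Qed.

Canonical tens_equiv :=
  EquivRel tens_relb tens_relb_refl tens_relb_sym tens_relb_trans.

Definition tens : Type := {eq_quot tens_equiv}.
HB.instance Definition _ := Quotient.on tens.
HB.instance Definition _ := Choice.on tens.

Lemma tens_piP (s t : seq (U * V)) : \pi_tens s = \pi_tens t <-> tens_rel s t.
Proof.
split; first by move/eqmodP/asboolP.
by move=> st; apply/eqmodP/asboolP.
Qed.

Lemma tens_reprP (s : seq (U * V)) : tens_rel (repr (\pi_tens s)) s.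
Proof. by apply/tens_piP; rewrite reprK. Qed.

Definition tadd (x y : tens) : tens := \pi_tens (repr x ++ repr y).
Definition tscale (a : K) (x : tens) : tens :=
  \pi_tens [seq (a *: p.1, p.2) | p <- repr x].

Lemma tens_rel_scale a (s t : seq (U * V)) : tens_rel s t ->
  tens_rel [seq (a *: p.1, p.2) | p <- s] [seq (a *: p.1, p.2) | p <- t].
Proof.
elim=> {s t} [s|s t _|s t r _ st _|s s' t t' _ ss _|s t|u u' v|u v v'|b u v|v] /=.
- exact: tens_refl.
- exact: tens_sym.
- exact: tens_trans.
- by rewrite !map_cat; apply: tens_cat.
- by rewrite !map_cat; apply: tens_catC.
- by rewrite scalerDr; apply: tens_addl.
- exact: tens_addr.
- by rewrite scalerA mulrC -scalerA; apply: tens_scale.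
- by rewrite scaler0; apply: tens_zero.
Qed.

Lemma tadd_pi s t : tadd (\pi_tens s) (\pi_tens t) = \pi_tens (s ++ t).
Proof. by apply/tens_piP/tens_cat; apply: tens_reprP. Qed.

Lemma tscale_pi a s :
  tscale a (\pi_tens s) = \pi_tens [seq (a *: p.1, p.2) | p <- s].
Proof. by apply/tens_piP/tens_rel_scale; apply: tens_reprP. Qed.

Lemma tens_pi_ind (P : tens -> Prop) : (forall s, P (\pi_tens s)) -> forall x, P x.
Proof. by move=> Ps x; rewrite -(reprK x). Qed.

Fact taddA : associative tadd.
Proof.
elim/tens_pi_ind=> s; elim/tens_pi_ind=> t; elim/tens_pi_ind=> r.
by rewrite !tadd_pi catA.
Qed.

Fact taddC : commutative tadd.
Proof.
elim/tens_pi_ind=> s; elim/tens_pi_ind=> t.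
by rewrite !tadd_pi; apply/tens_piP/tens_catC.
Qed.

Fact tadd0 : left_id (\pi_tens [::]) tadd.
Proof. by elim/tens_pi_ind=> s; rewrite tadd_pi. Qed.

Lemma tscaleDl_pi a b s :
  tadd (tscale a (\pi_tens s)) (tscale b (\pi_tens s)) = tscale (a + b) (\pi_tens s).
Proof.
rewrite !tscale_pi tadd_pi; apply/tens_piP; elim: s => [|[u v] s IHs] /=.
  exact: tens_refl.
apply: (@tens_trans _ ([:: (a *: u, v); (b *: u, v)] ++
  ([seq (a *: p.1, p.2) | p <- s] ++ [seq (b *: p.1, p.2) | p <- s]))).
  rewrite -cat1s -[X in tens_rel _ X]cat1s; apply: tens_cat; first exact: tens_refl.
  rewrite -[in X in tens_rel X _]cat1s catA -[X in tens_rel _ X]cat1s catA.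
  by apply: tens_cat; [apply: tens_catC | apply: tens_refl].
rewrite -[X in tens_rel _ X]cat1s; apply: tens_cat; last exact: IHs.
by rewrite scalerDl; apply/tens_sym/tens_addl.
Qed.

Lemma tscale0_pi s : tscale 0 (\pi_tens s) = \pi_tens [::].
Proof.
rewrite tscale_pi; apply/tens_piP; elim: s => [|[u v] s IHs] /=; first exact: tens_refl.
rewrite -cat1s -[[::]]cats0; apply: tens_cat => //.
by rewrite scale0r; apply: tens_zero.
Qed.

Lemma tscale1 : left_id 1 tscale.
Proof.
elim/tens_pi_ind=> s; rewrite tscale_pi; congr (\pi_tens _).
by rewrite -[RHS]map_id; apply: eq_map => -[u v] /=; rewrite scale1r.
Qed.

Fact taddN : left_inverse (\pi_tens [::]) (tscale (-1)) tadd.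
Proof.
elim/tens_pi_ind=> s.
by rewrite -[X in tadd _ X]tscale1 tscaleDl_pi addNr tscale0_pi.
Qed.

HB.instance Definition _ :=
  GRing.isZmodule.Build tens taddA taddC tadd0 taddN.

Fact tscaleA a b x : tscale a (tscale b x) = tscale (a * b) x.
Proof.
elim/tens_pi_ind: x => s; rewrite !tscale_pi -map_comp; congr (\pi_tens _).
by apply: eq_map => -[u v] /=; rewrite scalerA.
Qed.

Fact tscaleDr : right_distributive tscale tadd.
Proof.
move=> a; elim/tens_pi_ind=> s; elim/tens_pi_ind=> t.
by rewrite tadd_pi !tscale_pi tadd_pi map_cat.
Qed.

Fact tscaleDl x a b : tscale (a + b) x = tadd (tscale a x) (tscale b x).
Proof. by elim/tens_pi_ind: x => s; rewrite -tscaleDl_pi. Qed.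

HB.instance Definition _ :=
  GRing.Zmodule_isLmodule.Build K tens tscaleA tscale1 tscaleDr tscaleDl.

Definition tpure (u : U) (v : V) : tens := \pi_tens [:: (u, v)].

(* The sum of f u v over a chosen decomposition of t into pure tensors.  By
   tsumE and tsum_linear, this does not depend on the decomposition when f is
   bilinear. *)
Definition tsum (W : lmodType K) (f : U -> V -> W) (t : tens) : W :=
  \sum_(p <- repr t) f p.1 p.2.

End TensorProduct.

Arguments tpure {K U V}.
Arguments tsum {K U V W}.

Notation "U ⨂ V" := (tens U V).
Notation "u ⊗ v" := (tpure u v) : ring_scope.
Notation "'Σ(' u ⊗ v ':=' t ) E" := (tsum (fun u v => E) t) : ring_scope.

Section TensorTheory.
Variables (K : fieldType).
Implicit Types U V W X Y : lmodType K.

Lemma tens_pi_add U V (s t : seq (U * V)) :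
  \pi_(U ⨂ V) (s ++ t) = \pi_(U ⨂ V) s + \pi_(U ⨂ V) t.
Proof. by rewrite /GRing.add /= tadd_pi. Qed.

Lemma tpureDl U V (u u' : U) (v : V) : (u + u') ⊗ v = u ⊗ v + u' ⊗ v.
Proof. by rewrite /tpure -tens_pi_add; apply/tens_piP/tens_addl. Qed.

Lemma tpureDr U V (u : U) (v v' : V) : u ⊗ (v + v') = u ⊗ v + u ⊗ v'.
Proof. by rewrite /tpure -tens_pi_add; apply/tens_piP/tens_addr. Qed.

Lemma tpureZl U V a (u : U) (v : V) : (a *: u) ⊗ v = a *: (u ⊗ v).
Proof. by rewrite /tpure [RHS]/GRing.scale /= tscale_pi. Qed.

Lemma tpureZr U V a (u : U) (v : V) : u ⊗ (a *: v) = a *: (u ⊗ v).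
Proof. by rewrite -tpureZl; apply/tens_piP/tens_sym/tens_scale. Qed.

Lemma tens_decomp U V (x : U ⨂ V) : x = \sum_(p <- repr x) p.1 ⊗ p.2.
Proof.
rewrite -[LHS]reprK; elim: (repr x) => [|[u v] s IHs]; first by rewrite big_nil.
by rewrite big_cons -IHs -cat1s tens_pi_add.
Qed.

Definition bilin U V W (f : U -> V -> W) :=
  (forall v, linear (f^~ v)) /\ (forall u, linear (f u)).

Lemma linear_add U W (f : U -> W) : linear f -> {morph f : x y / x + y}.
Proof. by move=> lf x y; rewrite -[x]scale1r lf !scale1r. Qed.

Lemma linear_zero U W (f : U -> W) : linear f -> f 0 = 0.
Proof. by move=> lf; apply: (addrI (f 0)); rewrite -linear_add // !addr0. Qed.

Lemma linear_scale U W (f : U -> W) a x : linear f -> f (a *: x) = a *: f x.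
Proof. by move=> lf; rewrite -[a *: x]addr0 lf linear_zero // addr0. Qed.

Lemma tsum_pi U V W (f : U -> V -> W) (s : seq (U * V)) : bilin f ->
  tsum f (\pi_(U ⨂ V) s) = \sum_(p <- s) f p.1 p.2.
Proof.
move=> [fl fr]; rewrite /tsum; move: (repr _) (tens_reprP s) => r rs.
elim: rs => {s r}
  [s|s t _ ->|s t r _ -> _ ->|s s' t t' _ E _ E'|s t|u u' v|u v v'|a u v|v] //.
- by rewrite !big_cat E E'.
- by rewrite !big_cat /= addrC.
- by rewrite !big_cons !big_nil /= (linear_add (fl v)) !addr0.
- by rewrite !big_cons !big_nil /= (linear_add (fr u)) !addr0.
- by rewrite !big_cons !big_nil /= (linear_scale _ _ (fl v)) (linear_scale _ _ (fr u)).
- by rewrite !big_cons !big_nil /= (linear_zero (fl v)) addr0.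
Qed.

Lemma tsumE U V W (f : U -> V -> W) u v : bilin f -> tsum f (u ⊗ v) = f u v.
Proof. by move=> bf; rewrite tsum_pi // big_seq1. Qed.

Lemma tsum_linear U V W (f : U -> V -> W) : bilin f -> linear (tsum f).
Proof.
move=> bf a x y; rewrite -[x in LHS]reprK -[y in LHS]reprK.
rewrite [a *: _]/GRing.scale /= tscale_pi -tens_pi_add tsum_pi //.
rewrite big_cat big_map /= /tsum scaler_sumr; congr (_ + _).
by apply: eq_bigr => p _; rewrite (linear_scale _ _ (bf.1 _)).
Qed.

Lemma tens_ext U V W (f g : U ⨂ V -> W) : linear f -> linear g ->
  (forall u v, f (u ⊗ v) = g (u ⊗ v)) -> f =1 g.
Proof.
move=> lf lg fg x; rewrite [x]tens_decomp.
elim: (repr x) => [|p s IHs]; first by rewrite !big_nil !linear_zero.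
by rewrite !big_cons (linear_add lf) (linear_add lg) fg IHs.
Qed.

Definition lin_of U W (f : U -> W) (lf : linear f) : {linear U -> W} :=
  HB.pack f (GRing.isLinear.Build K U W *:%R f lf).

Lemma lin_id U : linear (fun x : U => x).
Proof. by []. Qed.

Lemma lin_app U V W (g : {linear V -> W}) (f : U -> V) :
  linear f -> linear (fun x => g (f x)).
Proof. by move=> lf a x y; rewrite lf linearP. Qed.

Lemma lin_purel U V W (f : U -> V) (w : W) : linear f -> linear (fun x => f x ⊗ w).
Proof. by move=> lf a x y; rewrite lf tpureDl tpureZl. Qed.

Lemma lin_purer U V W (f : U -> V) (w : W) : linear f -> linear (fun x => w ⊗ f x).
Proof. by move=> lf a x y; rewrite lf tpureDr tpureZr. Qed.

Lemma lin_scalel U W (f : U -> K^o) (w : W) :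
  linear f -> linear (fun x => (f x : K) *: w).
Proof. by move=> lf a x y; rewrite lf scalerDl scalerA. Qed.

Lemma lin_scaler U W (f : U -> W) (k : K) : linear f -> linear (fun x => k *: f x).
Proof. by move=> lf a x y; rewrite lf scalerDr !scalerA mulrC. Qed.

Lemma lin_mull U (f : U -> K^o) (k : K^o) : linear f -> linear (fun x => f x * k).
Proof. by move=> lf a x y; rewrite lf mulrDl -scalerAl. Qed.

Lemma lin_mulr U (f : U -> K^o) (k : K^o) : linear f -> linear (fun x => k * f x).
Proof. by move=> lf a x y; rewrite lf mulrDr [k * (a *: _)]mulrCA. Qed.

Lemma lin_body U V W X (F : X -> U -> V -> W) (t : U ⨂ V) :
  (forall u v, linear (fun x => F x u v)) -> linear (fun x => tsum (F x) t).
Proof.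
move=> lF a x y; rewrite /tsum scaler_sumr -big_split /=.
by apply: eq_bigr => p _; rewrite lF.
Qed.

Lemma lin_arg U V W X (F : U -> V -> W) (f : X -> U ⨂ V) :
  linear f -> (forall v, linear (F^~ v)) -> (forall u, linear (F u)) ->
  linear (fun x => tsum F (f x)).
Proof. by move=> lf Fl Fr a x y; rewrite lf tsum_linear. Qed.

End TensorTheory.

Ltac lin_step :=
  cbv beta;
  first [ exact: lin_id
        | apply: lin_scalel | apply: lin_scaler | apply: lin_mull | apply: lin_mulr
        | apply: lin_purel | apply: lin_purer
        | (apply: lin_body => ? ?) | (apply: lin_arg => [|?|?])
        | apply: lin_app ].
Ltac prove_linear := repeat lin_step.

Section LinearMaps.
Variable K : fieldType.
Implicit Types U V W X : lmodType K.

Fact tmap_linear U V U' V' (f : {linear U -> U'}) (g : {linear V -> V'}) :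
  linear (fun x : U ⨂ V => Σ(u ⊗ v := x) f u ⊗ g v).
Proof. prove_linear. Qed.
Definition tmap U V U' V' (f : {linear U -> U'}) (g : {linear V -> V'}) :
  {linear U ⨂ V -> U' ⨂ V'} := lin_of (tmap_linear f g).

(* id_U ⊗ c ⊗ id_X, up to plain (untwisted) rebracketing. *)
Fact tmid_linear U V W X (c : {linear V ⨂ W -> W ⨂ V}) :
  linear (fun t : (U ⨂ V) ⨂ (W ⨂ X) =>
    Σ(x ⊗ y := t) Σ(u ⊗ v := x) Σ(w ⊗ z := y) Σ(w' ⊗ v' := c (v ⊗ w))
      (u ⊗ w') ⊗ (v' ⊗ z)).
Proof. prove_linear. Qed.
Definition tmid U V W X (c : {linear V ⨂ W -> W ⨂ V}) :
  {linear (U ⨂ V) ⨂ (W ⨂ X) -> (U ⨂ W) ⨂ (V ⨂ X)} := lin_of (tmid_linear c).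

Record lin_aut V := LinAut {
  aut_map :> {linear V -> V};
  aut_inv : {linear V -> V};
  aut_mapK : cancel aut_map aut_inv;
  aut_invK : cancel aut_inv aut_map }.

Lemma bij_lin_aut V (f : {linear V -> V}) :
  bijective f -> exists g : lin_aut V, aut_map g = f.
Proof.
case=> g fK gK; have lg : linear g by apply: can2_linear fK gK.
by exists (@LinAut _ f (lin_of lg) fK gK).
Qed.

Fact tens_aut_cancel U V (f f' : {linear U -> U}) (g g' : {linear V -> V}) :
  cancel f f' -> cancel g g' -> cancel (tmap f g) (tmap f' g').
Proof.
move=> fK gK; apply: tens_ext => [||u v].
- by move=> a x y; rewrite !linearP.
- by [].
by rewrite /= !tsumE ?fK ?gK //; split=> ?; prove_linear.
Qed.

Definition tens_aut U V (f : lin_aut U) (g : lin_aut V) : lin_aut (U ⨂ V) :=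
  LinAut (tens_aut_cancel (aut_mapK f) (aut_mapK g))
         (tens_aut_cancel (aut_invK f) (aut_invK g)).

Definition id_aut V : lin_aut V :=
  @LinAut V (lin_of (@lin_id K V)) (lin_of (@lin_id K V))
    (fun=> erefl) (fun=> erefl).

End LinearMaps.

Arguments tmid {K U V W X}.

Notation "f ⁻¹" := (aut_inv f) (at level 2, left associativity, format "f ⁻¹").

Section HomStructures.
Variable K : fieldType.

(* Algebra and coalgebra structure maps on one space, sharing the automorphism;
   hom_algebra and hom_coalgebra each constrain only their own part. *)
Record hom_data (V : lmodType K) := HomData {
  mul : {linear V ⨂ V -> V};
  one : V;
  comul : {linear V -> V ⨂ V};
  counit : {linear V -> K^o};
  aut : lin_aut V }.

Local Notation "a ·[ D ] b" := (mul D (a ⊗ b))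
  (at level 40, left associativity, format "a  ·[ D ]  b").
Local Notation "h ▷[ act ] m" := (act (h ⊗ m))
  (at level 38, right associativity, format "h  ▷[ act ]  m").

Record hom_algebra (V : lmodType K) (D : hom_data V) : Prop := {
  aut_mul : forall a b, aut D (a ·[D] b) = aut D a ·[D] aut D b;
  aut_one : aut D (one D) = one D;
  mul_assoc : forall a b c, aut D a ·[D] (b ·[D] c) = (a ·[D] b) ·[D] aut D c;
  mul_one : forall a, a ·[D] one D = aut D a;
  one_mul : forall a, one D ·[D] a = aut D a }.

Record hom_coalgebra (V : lmodType K) (D : hom_data V) : Prop := {
  comul_aut : forall c,
    comul D (aut D c) = Σ(c1 ⊗ c2 := comul D c) aut D c1 ⊗ aut D c2;
  counit_aut : forall c, counit D (aut D c) = counit D c;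
  comul_coassoc : forall c,
    Σ(c1 ⊗ c2 := comul D c) Σ(c21 ⊗ c22 := comul D c2)
      aut D c1 ⊗ (c21 ⊗ c22)
    = Σ(c1 ⊗ c2 := comul D c) Σ(c11 ⊗ c12 := comul D c1)
      c11 ⊗ (c12 ⊗ aut D c2);
  counit_comul : forall c,
    Σ(c1 ⊗ c2 := comul D c) (counit D c1 : K) *: c2 = aut D c;
  comul_counit : forall c,
    Σ(c1 ⊗ c2 := comul D c) (counit D c2 : K) *: c1 = aut D c }.

Record hom_bialgebra (H : lmodType K) (D : hom_data H) : Prop := {
  hom_bialgebra_algebra : hom_algebra D;
  hom_bialgebra_coalgebra : hom_coalgebra D;
  comul_mul : forall h h',
    comul D (h ·[D] h')
    = Σ(h1 ⊗ h2 := comul D h) Σ(h1' ⊗ h2' := comul D h')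
      (h1 ·[D] h1') ⊗ (h2 ·[D] h2');
  comul_one : comul D (one D) = one D ⊗ one D;
  counit_mul : forall h h', counit D (h ·[D] h') = counit D h * counit D h';
  counit_one : counit D (one D) = 1 }.

Record hom_hopf (H : lmodType K) (D : hom_data H) (S : {linear H -> H}) : Prop := {
  hom_hopf_bialgebra : hom_bialgebra D;
  antipode_mul : forall h,
    Σ(h1 ⊗ h2 := comul D h) S h1 ·[D] h2 = (counit D h : K) *: one D;
  mul_antipode : forall h,
    Σ(h1 ⊗ h2 := comul D h) h1 ·[D] S h2 = (counit D h : K) *: one D;
  antipode_aut : forall h, S (aut D h) = aut D (S h) }.

Section OverH.
Variables (H : lmodType K) (DH : hom_data H).
Local Notation β := (aut DH).
Local Notation "h · h'" := (mul DH (h ⊗ h')) (at level 40, left associativity).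

Record hom_module (M : lmodType K) (act : {linear H ⨂ M -> M})
    (α : lin_aut M) : Prop := {
  aut_act : forall h m, α (h ▷[act] m) = β h ▷[act] α m;
  act_assoc : forall h h' m, β h ▷[act] (h' ▷[act] m) = (h · h') ▷[act] α m;
  one_act : forall m, one DH ▷[act] m = α m }.

Record hom_comodule (M : lmodType K) (coact : {linear M -> H ⨂ M})
    (α : lin_aut M) : Prop := {
  coact_aut : forall m, coact (α m) = Σ(h ⊗ n := coact m) β h ⊗ α n;
  coact_coassoc : forall m,
    Σ(h ⊗ n := coact m) Σ(h' ⊗ n' := coact n) β h ⊗ (h' ⊗ n')
    = Σ(h ⊗ n := coact m) Σ(h1 ⊗ h2 := comul DH h) h1 ⊗ (h2 ⊗ α n);
  counit_coact : forall m, Σ(h ⊗ n := coact m) (counit DH h : K) *: n = α m }.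

Record module_hom_algebra (A : lmodType K) (DA : hom_data A)
    (act : {linear H ⨂ A -> A}) : Prop := {
  module_hom_algebra_algebra : hom_algebra DA;
  module_hom_algebra_module : hom_module act (aut DA);
  act_mul : forall h a a',
    β (β h) ▷[act] (a ·[DA] a')
    = Σ(h1 ⊗ h2 := comul DH h) (h1 ▷[act] a) ·[DA] (h2 ▷[act] a');
  act_one : forall h, h ▷[act] one DA = (counit DH h : K) *: one DA }.

Record comodule_hom_coalgebra (C : lmodType K) (DC : hom_data C)
    (coact : {linear C -> H ⨂ C}) : Prop := {
  comodule_hom_coalgebra_coalgebra : hom_coalgebra DC;
  comodule_hom_coalgebra_comodule : hom_comodule coact (aut DC);
  coact_comul : forall c,
    Σ(h ⊗ d := coact c) Σ(d1 ⊗ d2 := comul DC d) β (β h) ⊗ (d1 ⊗ d2)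
    = Σ(c1 ⊗ c2 := comul DC c) Σ(h ⊗ d1 := coact c1) Σ(h' ⊗ d2 := coact c2)
      (h · h') ⊗ (d1 ⊗ d2);
  coact_counit : forall c,
    Σ(h ⊗ d := coact c) (counit DC d : K) *: h = (counit DC c : K) *: one DH }.

Record yd_data := YDData {
  yd_space :> lmodType K;
  yd_act : {linear H ⨂ yd_space -> yd_space};
  yd_coact : {linear yd_space -> H ⨂ yd_space};
  yd_aut : lin_aut yd_space }.

Local Notation "h ▷ m" := (yd_act _ (h ⊗ m)) (at level 38, right associativity).

Record yd_module (M : yd_data) : Prop := {
  yd_module_module : hom_module (yd_act M) (yd_aut M);
  yd_module_comodule : hom_comodule (yd_coact M) (yd_aut M);
  yd_compat : forall (h : H) (m : M),
    Σ(h1 ⊗ h2 := comul DH h) Σ(k ⊗ n := yd_coact M m)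
      (h1 · β k) ⊗ (β (β (β h2)) ▷ n)
    = Σ(h1 ⊗ h2 := comul DH h) Σ(k ⊗ n := yd_coact M (β (β h1) ▷ m))
      (k · h2) ⊗ n }.

Record yd_morphism (M N : yd_data) (f : {linear M -> N}) : Prop := {
  yd_morphism_act : forall (h : H) (m : M), f (h ▷ m) = h ▷ f m;
  yd_morphism_coact : forall m : M,
    yd_coact N (f m) = Σ(h ⊗ n := yd_coact M m) h ⊗ f n;
  yd_morphism_aut : forall m : M, yd_aut N (f m) = f (yd_aut M m) }.

Section Tensor.
Variables M N : yd_data.

Fact yd_tensor_act_linear : linear (fun t : H ⨂ (M ⨂ N) =>
  Σ(h ⊗ x := t) Σ(m ⊗ n := x) Σ(h1 ⊗ h2 := comul DH h) (h1 ▷ m) ⊗ (h2 ▷ n)).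
Proof. prove_linear. Qed.

Fact yd_tensor_coact_linear : linear (fun x : M ⨂ N =>
  Σ(m ⊗ n := x) Σ(h ⊗ m0 := yd_coact M m) Σ(k ⊗ n0 := yd_coact N n)
    β⁻¹ (β⁻¹ (h · k)) ⊗ (m0 ⊗ n0)).
Proof. prove_linear. Qed.

Definition yd_tensor : yd_data := {|
  yd_space := M ⨂ N;
  yd_act := lin_of yd_tensor_act_linear;
  yd_coact := lin_of yd_tensor_coact_linear;
  yd_aut := tens_aut (yd_aut M) (yd_aut N) |}.

Fact yd_braiding_linear : linear (fun x : M ⨂ N =>
  Σ(m ⊗ n := x) Σ(h ⊗ m0 := yd_coact M m)
    (β (β h) ▷ (yd_aut N)⁻¹ n) ⊗ (yd_aut M)⁻¹ m0).
Proof. prove_linear. Qed.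
Definition yd_braiding : {linear M ⨂ N -> N ⨂ M} := lin_of yd_braiding_linear.

End Tensor.

Fact yd_unit_act_linear : linear (fun t : H ⨂ K^o =>
  Σ(h ⊗ k := t) counit DH h * k).
Proof. prove_linear. Qed.

Fact yd_unit_coact_linear : linear (fun k : K^o => one DH ⊗ k).
Proof. prove_linear. Qed.

Definition yd_unit : yd_data := {|
  yd_space := K^o;
  yd_act := lin_of yd_unit_act_linear;
  yd_coact := lin_of yd_unit_coact_linear;
  yd_aut := id_aut K^o |}.

Section BialgebraInYD.
Variables (A : lmodType K) (DA : hom_data A).
Variables (act : {linear H ⨂ A -> A}) (coact : {linear A -> H ⨂ A}).

Fact unit_map_linear : linear (fun k : K^o => (k : K) *: one DA).
Proof. prove_linear. Qed.
Definition unit_map : {linear K^o -> A} := lin_of unit_map_linear.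

Definition yd_of : yd_data := YDData act coact (aut DA).

Record yd_bialgebra : Prop := {
  yd_bialgebra_object : yd_module yd_of;
  yd_bialgebra_mul : @yd_morphism (yd_tensor yd_of yd_of) yd_of (mul DA);
  yd_bialgebra_one : @yd_morphism yd_unit yd_of unit_map;
  yd_bialgebra_comul : @yd_morphism yd_of (yd_tensor yd_of yd_of) (comul DA);
  yd_bialgebra_counit : @yd_morphism yd_of yd_unit (counit DA);
  yd_comul_mul : forall x : A ⨂ A,
    comul DA (mul DA x)
    = tmap (mul DA) (mul DA)
        (tmid (yd_braiding yd_of yd_of) (tmap (comul DA) (comul DA) x));
  yd_comul_one : comul DA (one DA) = one DA ⊗ one DA;
  yd_counit_mul : forall a b, counit DA (a ·[DA] b) = counit DA a * counit DA b;
  yd_counit_one : counit DA (one DA) = 1 }.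

Local Notation α := (aut DA).

Fact biprod_mul_linear : linear (fun t : (A ⨂ H) ⨂ (A ⨂ H) =>
  Σ(x ⊗ y := t) Σ(a ⊗ h := x) Σ(a' ⊗ h' := y) Σ(h1 ⊗ h2 := comul DH h)
    (a ·[DA] (h1 ▷[act] α⁻¹ a')) ⊗ (β⁻¹ h2 · h')).
Proof. prove_linear. Qed.

Fact biprod_comul_linear : linear (fun x : A ⨂ H =>
  Σ(a ⊗ h := x) Σ(a1 ⊗ a2 := comul DA a) Σ(k ⊗ a20 := coact a2)
    Σ(h1 ⊗ h2 := comul DH h) (a1 ⊗ (k · β⁻¹ h1)) ⊗ (α⁻¹ a20 ⊗ h2)).
Proof. prove_linear. Qed.

Fact biprod_counit_linear : linear (fun x : A ⨂ H =>
  Σ(a ⊗ h := x) counit DA a * counit DH h).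
Proof. prove_linear. Qed.

Definition biproduct : hom_data (A ⨂ H) := {|
  mul := lin_of biprod_mul_linear;
  one := one DA ⊗ one DH;
  comul := lin_of biprod_comul_linear;
  counit := lin_of biprod_counit_linear;
  aut := tens_aut α β |}.

Lemma biproduct_mulE a h a' h' :
  mul biproduct ((a ⊗ h) ⊗ (a' ⊗ h'))
  = Σ(h1 ⊗ h2 := comul DH h) (a ·[DA] (h1 ▷[act] α⁻¹ a')) ⊗ (β⁻¹ h2 · h').
Proof. by rewrite /= !tsumE //; split=> ?; prove_linear. Qed.

Lemma biproduct_comulE a h :
  comul biproduct (a ⊗ h)
  = Σ(a1 ⊗ a2 := comul DA a) Σ(k ⊗ a20 := coact a2)
    Σ(h1 ⊗ h2 := comul DH h) (a1 ⊗ (k · β⁻¹ h1)) ⊗ (α⁻¹ a20 ⊗ h2).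
Proof. by rewrite /= tsumE //; split=> ?; prove_linear. Qed.

End BialgebraInYD.
End OverH.
End HomStructures.

(* Main.v *)
(** Let [πA = id ⊗ ε] and [πH = εA ⊗ id] be the projections of [A ⊗ H].  If the
    biproduct is a Hom-bialgebra, then applying [πA ⊗ πA] and [πH ⊗ πA] to
    [Δ(xy) = Δ(x)Δ(y)] gives the conditions on [A]: [x = a ⊗ 1], [y = b ⊗ 1] yield
    the braided formula for [Δ(ab)] and the colinearity of the product, while
    [x = 1 ⊗ h], [y = a ⊗ 1] yield the linearity of [ΔA] and the Yetter-Drinfeld
    compatibility.  Conversely, in the expansion of [Δ((a ⊗ h)(b ⊗ k))] the two middle
    legs of the four-fold coproduct of [h] meet the coaction of the second leg of [b]
    exactly as in the Yetter-Drinfeld compatibility. *)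

From mathcomp Require Import all_boot all_algebra.
Require Import Defs.
Set Implicit Arguments.
Unset Strict Implicit.
Unset Printing Implicit Defensive.
Import GRing.Theory.
Local Open Scope ring_scope.

(** * Sweedler calculus by multilinearity *)

Lemma lin_tpure (K : fieldType) (U V : lmodType K) (u : U) :
  linear (tpure u : V -> U ⨂ V).
Proof. exact: lin_purer (@lin_id _ _). Qed.

(** The rule is selected by the head of the body of the function; [lin_step], which tries the rules
    in turn, is only the fallback. *)
Ltac lin_head :=
  cbv beta;
  lazymatch goal with
  | |- _ (fun x => x) => exact: lin_id
  | |- _ (fun x => @GRing.Linear.sort _ _ _ _ _ (@?f x)) => apply: lin_app
  | |- _ (fun x => tpure (@?f x) (@?g x)) => first [apply: lin_purel | apply: lin_purer]
  | |- _ (fun x => tsum (@?f x) (@?g x)) =>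
      first [apply: lin_body => ? ? | apply: lin_arg => [|?|?]]
  | |- _ (tpure _) => exact: lin_tpure
  | |- _ => lin_step
  end.

Ltac linears := by repeat lin_head.
Ltac bilinear := by split=> ?; linears.
Ltac tsimp := repeat (rewrite tsumE; [|bilinear]).
(* If both sides of the goal are linear in the tensor [t0], it may be replaced by a
   pure tensor: this is how a Sweedler sum over [t0] is opened on both sides at once.
   The elaborated types of [comul], [act] and [coact] contain [reverse_coercion],
   which must be unfolded for all occurrences to be syntactically equal. *)
Ltac telim t0 :=
  cbv beta delta [reverse_coercion];
  let t := eval cbv beta delta [reverse_coercion] in t0 in
  match goal with |- ?L = ?R =>
    let L' := eval pattern t in L in
    let R' := eval pattern t in R in
    match L' with ?f _ => match R' with ?g _ =>
      refine (@tens_ext _ _ _ _ f g _ _ _ t);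
      [ linears | linears
      | let u := fresh in let v := fresh in
        intros u v; cbv beta; tsimp; revert u v ]
    end end
  end.

(* [dl] and [dr] are both the comultiplication, or the comultiplication and the
   coaction of a comodule. *)
Section Coassoc.
Variable K : fieldType.
Variables U V Q W : lmodType K.
Variables (dl : {linear U -> U ⨂ Q}) (dr : {linear V -> Q ⨂ V}).
Variables (f : lin_aut U) (g : lin_aut V) (t : U ⨂ V).
Hypothesis coassoc :
  Σ(u ⊗ v := t) Σ(x ⊗ y := dr v) f u ⊗ (x ⊗ y)
    = Σ(u ⊗ v := t) Σ(x ⊗ y := dl u) x ⊗ (y ⊗ g v).

(** A linear map is applied to [coassoc]. It is [B], rebracketed and precomposed with [g⁻¹] on the
    last leg: this cancels the twist on one side, and on the other side the hypothesis relating [B]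
    to [C] absorbs both [f] and [g⁻¹]. *)
Lemma coassoc_lin (B : {linear (U ⨂ Q) ⨂ V -> W}) (C : {linear U ⨂ (Q ⨂ V) -> W}) :
  (forall x y z, B ((f x ⊗ y) ⊗ z) = C (x ⊗ (y ⊗ g z))) ->
  Σ(u ⊗ v := t) B (dl u ⊗ v) = Σ(u ⊗ v := t) C (u ⊗ dr v).
Proof.
move=> BC.
pose P (s : U ⨂ (Q ⨂ V)) := Σ(x ⊗ r := s) Σ(y ⊗ z := r) B ((x ⊗ y) ⊗ g⁻¹ z).
have lP : linear P by rewrite /P; linears.
have := congr1 P coassoc.
transitivity (P (Σ(u ⊗ v := t) Σ(x ⊗ y := dl u) x ⊗ (y ⊗ g v))).
  rewrite /P; telim t => u v; telim (dl u) => x y.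
  by rewrite aut_mapK.
rewrite -coassoc /P; telim t => u v; telim (dr v) => x y.
by rewrite BC aut_invK.
Qed.

(** The form used by [tcoassoc]: [F] and [G] are read off the two sides of a goal by abstracting
    [t], while [F1] and [G1], which expose the split leg as an argument, are left to unification. *)
Lemma coassoc_ext
    (F G : U ⨂ V -> W) (F1 : U ⨂ Q -> V -> W) (G1 : U -> Q ⨂ V -> W) :
  linear F -> linear G ->
  (forall u v, F (u ⊗ v) = F1 (dl u) v) ->
  (forall u v, G (u ⊗ v) = G1 u (dr v)) ->
  bilin F1 -> bilin G1 ->
  (forall x y z, F1 (f x ⊗ y) z = G1 x (y ⊗ g z)) -> F t = G t.
Proof.
move=> lF lG FE GE bF1 bG1 F1G1.
have [B BE] : exists B : {linear (U ⨂ Q) ⨂ V -> W}, forall x v, B (x ⊗ v) = F1 x v.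
  by exists (lin_of (tsum_linear bF1)) => x v; exact: tsumE.
have [C CE] : exists C : {linear U ⨂ (Q ⨂ V) -> W}, forall u x, C (u ⊗ x) = G1 u x.
  by exists (lin_of (tsum_linear bG1)) => u x; exact: tsumE.
transitivity (Σ(u ⊗ v := t) B (dl u ⊗ v)).
  apply: (tens_ext (g := fun t => Σ(u ⊗ v := t) _)) => // [|u v]; first by linears.
  by tsimp; rewrite BE.
rewrite (coassoc_lin (C := C)); last by move=> x y z; rewrite BE CE.
apply: (tens_ext (f := fun t => Σ(u ⊗ v := t) _)) => // [|u v]; first by linears.
by tsimp; rewrite CE.
Qed.

End Coassoc.

(** Solves [E = ?x t v] by abstracting [t] and [v] in [E], a higher-order problem that plain
    unification cannot be trusted to solve when [t] is compound. *)
Ltac tfold t0 v0 :=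
  cbv beta delta [reverse_coercion];
  let t := eval cbv beta delta [reverse_coercion] in t0 in
  let v := eval cbv beta delta [reverse_coercion] in v0 in
  match goal with |- ?E = ?X =>
    let E' := eval pattern t, v in E in
    lazymatch E' with ?e _ _ =>
      lazymatch X with ?x _ _ => unify x e; reflexivity end
    end
  end.

(* Reduces a goal whose sides split the left leg, resp. the right leg, of [t0] to the
   identity between the summands provided by the coassociativity [H]. *)
Ltac tcoassoc H t0 dl0 dr0 :=
  cbv beta delta [reverse_coercion];
  let t := eval cbv beta delta [reverse_coercion] in t0 in
  let dl := eval cbv beta delta [reverse_coercion] in dl0 in
  let dr := eval cbv beta delta [reverse_coercion] in dr0 in
  match goal with |- ?L = ?R =>
    let L' := eval pattern t in L in
    let R' := eval pattern t in R in
    match L' with ?f _ => match R' with ?g _ =>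
      eapply (coassoc_ext H (F := f) (G := g));
      [ linears | linears
      | let u := fresh "u" in let v := fresh "v" in
        intros u v; cbv beta; tsimp; tfold (dl u) v
      | let u := fresh "u" in let v := fresh "v" in
        intros u v; cbv beta; tsimp; tfold u (dr v)
      | bilinear | bilinear
      | let x := fresh in let y := fresh in let z := fresh in
        intros x y z; cbv beta; tsimp; revert x y z ]
    end end
  end.

(** * Contraction of a Sweedler leg by a counit *)

Section Counit.
Variable K : fieldType.
Variables U V W : lmodType K.

(** [G] passes through the sum of the counit axiom. Both sums then run over the same chosen
    representative of [t], so their summands can be compared one by one. *)
Lemma tsum_counitl (e : {linear U -> K^o}) (t : U ⨂ V) (x : V)
    (F : U -> V -> W) (G : V -> W) :
  Σ(u ⊗ v := t) (e u : K) *: v = x -> linear G ->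
  (forall u v, F u v = (e u : K) *: G v) -> tsum F t = G x.
Proof.
move=> <- lG FG; rewrite -[G _]/(lin_of lG _) /tsum linear_sum.
by apply: eq_bigr => p _; rewrite linearZ FG.
Qed.

Lemma tsum_counitr (e : {linear V -> K^o}) (t : U ⨂ V) (x : U)
    (F : U -> V -> W) (G : U -> W) :
  Σ(u ⊗ v := t) (e v : K) *: u = x -> linear G ->
  (forall u v, F u v = (e v : K) *: G u) -> tsum F t = G x.
Proof.
move=> <- lG FG; rewrite -[G _]/(lin_of lG _) /tsum linear_sum.
by apply: eq_bigr => p _; rewrite linearZ FG.
Qed.

End Counit.

Section Maps.
Variable K : fieldType.
Implicit Types U V W X : lmodType K.

Lemma tmapE U V W X (f : {linear U -> W}) (g : {linear V -> X}) u v :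
  tmap f g (u ⊗ v) = f u ⊗ g v.
Proof. by rewrite /= tsumE //; bilinear. Qed.

Lemma tmidE U V W X (c : {linear V ⨂ W -> W ⨂ V}) (u : U) v w (z : X) :
  tmid c ((u ⊗ v) ⊗ (w ⊗ z)) = Σ(w' ⊗ v' := c (v ⊗ w)) (u ⊗ w') ⊗ (v' ⊗ z).
Proof. by rewrite /=; tsimp. Qed.

Lemma tens_autE U V (f : lin_aut U) (g : lin_aut V) u v :
  tens_aut f g (u ⊗ v) = f u ⊗ g v.
Proof. exact: tmapE. Qed.

Lemma lin_autP V (f : lin_aut V) (x y : V) : f x = y -> f⁻¹ y = x.
Proof. by move=> <-; rewrite aut_mapK. Qed.

End Maps.

(** * Exchange of coaction and comultiplication *)

Section CoactComul.
Variables (K : fieldType) (H : lmodType K) (DH : hom_data H).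
Hypothesis aut2 : forall h, aut DH (aut DH h) = h.
Variables (C : lmodType K) (DC : hom_data C) (coact : {linear C -> H ⨂ C}).
Hypothesis comodC : comodule_hom_coalgebra DH DC coact.
Variable W : lmodType K.

(** The analogue of [coassoc_ext] for the axiom [coact_comul], whose factor [β²] on the [H]-leg
    disappears by [aut2]. *)
Lemma coact_comul_ext (c : C) (F : H ⨂ C -> W) (G : C ⨂ C -> W)
    (F1 : H -> C ⨂ C -> W) (G1 : H ⨂ C -> H ⨂ C -> W) :
  linear F -> linear G ->
  (forall h d, F (h ⊗ d) = F1 h (comul DC d)) ->
  (forall c1 c2, G (c1 ⊗ c2) = G1 (coact c1) (coact c2)) ->
  bilin F1 -> bilin G1 ->
  (forall h k d e, F1 (mul DH (h ⊗ k)) (d ⊗ e) = G1 (h ⊗ d) (k ⊗ e)) ->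
  F (coact c) = G (comul DC c).
Proof.
move=> lF lG FE GE bF1 bG1 F1G1.
have [P PE] : exists P : {linear H ⨂ (C ⨂ C) -> W}, forall h x, P (h ⊗ x) = F1 h x.
  by exists (lin_of (tsum_linear bF1)) => h x; exact: tsumE.
have [Q QE] : exists Q : {linear (H ⨂ C) ⨂ (H ⨂ C) -> W},
    forall x y, Q (x ⊗ y) = G1 x y.
  by exists (lin_of (tsum_linear bG1)) => x y; exact: tsumE.
have := congr1 P (coact_comul comodC c).
have -> : P (Σ(h ⊗ d := coact c) Σ(d1 ⊗ d2 := comul DC d)
    aut DH (aut DH h) ⊗ (d1 ⊗ d2)) = F (coact c).
  telim (coact c) => //= h d; rewrite FE aut2 -PE.
  by telim (comul DC d) => d1 d2.
move=> ->; telim (comul DC c) => //= c1 c2; rewrite GE -QE.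
telim (coact c1) => h d; telim (coact c2) => k e.
by rewrite PE F1G1 QE.
Qed.

End CoactComul.

Ltac tcoact_comul H2 H c :=
  cbv beta delta [reverse_coercion];
  lazymatch type of H with comodule_hom_coalgebra ?DH ?DC ?coact =>
  let t := eval cbv beta delta [reverse_coercion] in (coact c) in
  let s := eval cbv beta delta [reverse_coercion] in (comul DC c) in
  match goal with |- ?L = ?R =>
    let L' := eval pattern t in L in
    let R' := eval pattern s in R in
    match L' with ?f _ => match R' with ?g _ =>
      eapply (coact_comul_ext H2 H c (F := f) (G := g));
      [ linears | linears
      | let u := fresh "u" in let v := fresh "v" in
        intros u v; cbv beta; tsimp; tfold u (comul DC v)
      | let u := fresh "u" in let v := fresh "v" in
        intros u v; cbv beta; tsimp; tfold (coact u) (coact v)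
      | bilinear | bilinear
      | let h := fresh in let k := fresh in let d := fresh in let e := fresh in
        intros h k d e; cbv beta; tsimp; revert h k d e ]
    end end
  end end.

(** * The biproduct *)

Section Radford.
Variables (K : fieldType) (H : lmodType K) (DH : hom_data H).
Hypothesis bH : hom_bialgebra DH.
Hypothesis aut2 : forall h, aut DH (aut DH h) = h.
Variables (A : lmodType K) (DA : hom_data A).
Variables (act : {linear H ⨂ A -> A}) (coact : {linear A -> H ⨂ A}).
Hypothesis modA : module_hom_algebra DH DA act.
Hypothesis comodA : comodule_hom_coalgebra DH DA coact.

Local Notation B := (biproduct DH DA act coact).
Local Notation β := (aut DH).
Local Notation α := (aut DA).
Local Notation Δ := (comul DH).
Local Notation ε := (counit DH).
Local Notation ΔA := (comul DA).
Local Notation εA := (counit DA).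
Local Notation "1H" := (one DH).
Local Notation "1A" := (one DA).
Local Notation "h · h'" := (mul DH (h ⊗ h')) (at level 40, left associativity).
Local Notation "a ∘ b" := (mul DA (a ⊗ b)) (at level 40, left associativity).
Local Notation "h ▷ a" := (act (h ⊗ a)) (at level 38, right associativity).

Implicit Types (h k l : H) (a b c : A).

Let algH := hom_bialgebra_algebra bH.
Let coalgH := hom_bialgebra_coalgebra bH.
Let algA := module_hom_algebra_algebra modA.
Let moduleA := module_hom_algebra_module modA.
Let coalgA := comodule_hom_coalgebra_coalgebra comodA.
Let comoduleA := comodule_hom_coalgebra_comodule comodA.

(** * The axioms as rewriting rules, under [β² = id] *)

Lemma autH_inv h : β⁻¹ h = β h.
Proof. by apply: lin_autP. Qed.

Lemma mulHA h k l : (h · k) · l = β h · (k · β l).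
Proof. by rewrite (mul_assoc algH) aut2. Qed.

Lemma mulAA a b c : (a ∘ b) ∘ c = α a ∘ (b ∘ α⁻¹ c).
Proof. by rewrite (mul_assoc algA) aut_invK. Qed.

Lemma act_actA h k a : (h · k) ▷ a = β h ▷ (k ▷ α⁻¹ a).
Proof. by rewrite (act_assoc moduleA) aut_invK. Qed.

Lemma autA_inv_mul a b : α⁻¹ (a ∘ b) = α⁻¹ a ∘ α⁻¹ b.
Proof. by apply: lin_autP; rewrite (aut_mul algA) !aut_invK. Qed.

Lemma autA_inv_one : α⁻¹ 1A = 1A.
Proof. exact: lin_autP (aut_one algA). Qed.

Lemma autA_inv_act h a : α⁻¹ (h ▷ a) = β h ▷ α⁻¹ a.
Proof. by apply: lin_autP; rewrite (aut_act moduleA) aut2 aut_invK. Qed.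

Lemma counitA_inv a : εA (α⁻¹ a) = εA a.
Proof. by rewrite -(counit_aut coalgA) aut_invK. Qed.

Lemma comulA_inv a : ΔA (α⁻¹ a) = Σ(a1 ⊗ a2 := ΔA a) α⁻¹ a1 ⊗ α⁻¹ a2.
Proof.
rewrite -[a in RHS](aut_invK α) (comul_aut coalgA).
transitivity (Σ(a1 ⊗ a2 := ΔA (α⁻¹ a)) a1 ⊗ a2); telim (ΔA (α⁻¹ a)) => u v //.
by rewrite !aut_mapK.
Qed.

Lemma coact_inv a : coact (α⁻¹ a) = Σ(h ⊗ a0 := coact a) β h ⊗ α⁻¹ a0.
Proof.
rewrite -[a in RHS](aut_invK α) (coact_aut comoduleA).
transitivity (Σ(a1 ⊗ a2 := coact (α⁻¹ a)) a1 ⊗ a2);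
  telim (coact (α⁻¹ a)) => u v //.
by rewrite aut2 aut_mapK.
Qed.

Lemma act_mul2 h a b : h ▷ (a ∘ b) = Σ(h1 ⊗ h2 := Δ h) (h1 ▷ a) ∘ (h2 ▷ b).
Proof. by rewrite -(act_mul modA) aut2. Qed.

(* Normal form of monomials: products and actions nested to the right, with the
   automorphisms on the variables. *)
Definition monomialE := (autH_inv, aut2, aut_mul algH, aut_one algH, mul_one algH,
  one_mul algH, mulHA, aut_mapK, aut_invK, aut_mul algA, aut_one algA,
  mul_one algA, one_mul algA, mulAA, autA_inv_mul, autA_inv_one,
  aut_act moduleA, autA_inv_act, act_actA, one_act moduleA).

(** * The smash product algebra and the smash coproduct coalgebra *)

Lemma biproduct_counitE a h : counit B (a ⊗ h) = εA a * ε h.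
Proof. by rewrite /= tsumE //; bilinear. Qed.

Lemma biproduct_algebra : hom_algebra B.
Proof.
split.
- move=> x y; telim x => a h; telim y => b k.
  rewrite biproduct_mulE !tens_autE biproduct_mulE (comul_aut coalgH).
  by telim (Δ h) => h1 h2; rewrite tens_autE !monomialE.
- by rewrite tens_autE !monomialE.
- move=> x y z; telim x => a h; telim y => b k; telim z => c l.
  rewrite !tens_autE !biproduct_mulE.
  (* Acting on a product in [A] splits the left leg of [Δ h], whereas the other bracketing
     comultiplies the right leg; coassociativity of [Δ] joins the two. *)
  transitivity (Σ(h1 ⊗ h2 := Δ h) Σ(k1 ⊗ k2 := Δ k) Σ(h3 ⊗ h4 := Δ h1)
      (α a ∘ ((β h3 ▷ α⁻¹ b) ∘ (β h4 ▷ α⁻¹ (k1 ▷ α⁻¹ c)))) ⊗ (h2 · (β k2 · l))).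
    telim (Δ k) => k1 k2; rewrite biproduct_mulE (comul_aut coalgH).
    telim (Δ h) => h1 h2; rewrite autA_inv_mul act_mul2 (comul_aut coalgH).
    by telim (Δ h1) => h3 h4; rewrite !monomialE.
  transitivity (Σ(h1 ⊗ h2 := Δ h) Σ(k1 ⊗ k2 := Δ k) Σ(h3 ⊗ h4 := Δ h2)
      ((a ∘ (h1 ▷ α⁻¹ b)) ∘ ((β h3 · k1) ▷ α⁻¹ (α c))) ⊗ (β⁻¹ (β h4 · k2) · β l)).
    tcoassoc (comul_coassoc coalgH h) (Δ h) (comul DH) (comul DH) => h1 h2 h3.
    by telim (Δ k) => k1 k2; rewrite !monomialE.
  telim (Δ h) => h1 h2; rewrite biproduct_mulE (comul_mul bH) autH_inv.
  rewrite (comul_aut coalgH); telim (Δ h2) => h3 h4; telim (Δ k) => k1 k2.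
  by rewrite !monomialE.
- move=> x; telim x => a h; rewrite biproduct_mulE tens_autE.
  apply: (tsum_counitl (counit_comul coalgH h) (G := fun h => α a ⊗ h)).
    by linears.
  move=> h1 h2.
  by rewrite !monomialE (act_one modA) tpureZr linearZ tpureZl !monomialE.
- move=> x; telim x => a h; rewrite biproduct_mulE tens_autE (comul_one bH).
  by tsimp; rewrite !monomialE.
Qed.

Lemma biproduct_coalgebra : hom_coalgebra B.
Proof.
split.
- move=> x; telim x => a h; rewrite tens_autE !biproduct_comulE.
  rewrite (comul_aut coalgA) (comul_aut coalgH).
  telim (ΔA a) => a1 a2; rewrite (coact_aut comoduleA).
  telim (coact a2) => k a3; telim (Δ h) => h1 h2.
  by rewrite !tens_autE !monomialE.
- move=> x; telim x => a h; rewrite tens_autE !biproduct_counitE.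
  by rewrite (counit_aut coalgA) (counit_aut coalgH).
- move=> x; telim x => a h; rewrite biproduct_comulE.
  transitivity (Σ(a1 ⊗ a2 := ΔA a) Σ(k ⊗ a3 := coact a2) Σ(h1 ⊗ h2 := Δ h)
    Σ(a4 ⊗ a5 := ΔA a3) Σ(l ⊗ a6 := coact a5) Σ(h3 ⊗ h4 := Δ h2)
    (α a1 ⊗ β (k · β h1)) ⊗
      ((α⁻¹ a4 ⊗ (β l · β h3)) ⊗ (α⁻¹ (α⁻¹ a6) ⊗ h4))).
    telim (ΔA a) => a1 a2; telim (coact a2) => k a3; telim (Δ h) => h1 h2.
    rewrite biproduct_comulE comulA_inv.
    telim (ΔA a3) => a4 a5; rewrite coact_inv.
    telim (coact a5) => l a6; telim (Δ h2) => h3 h4.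
    by rewrite tens_autE !monomialE.
  (* The comodule coalgebra axiom at [a2]: comultiplying after the coaction becomes coacting on both
     legs, with the [H]-legs multiplied. *)
  transitivity (Σ(a1 ⊗ a2 := ΔA a) Σ(b1 ⊗ b2 := ΔA a2) Σ(k1 ⊗ a4 := coact b1)
    Σ(k2 ⊗ a5 := coact b2) Σ(l ⊗ a6 := coact a5)
    Σ(h1 ⊗ h2 := Δ h) Σ(h3 ⊗ h4 := Δ h2)
    (α a1 ⊗ β ((k1 · k2) · β h1)) ⊗
      ((α⁻¹ a4 ⊗ (β l · β h3)) ⊗ (α⁻¹ (α⁻¹ a6) ⊗ h4))).
    telim (ΔA a) => a1 a2.
    tcoact_comul aut2 comodA a2 => k1 k2 a3 a4.
    by telim (Δ h) => h1 h2; telim (coact a4) => l a6.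
  (* The double coaction on [b2] becomes a coproduct of its [H]-leg. *)
  transitivity (Σ(a1 ⊗ a2 := ΔA a) Σ(b1 ⊗ b2 := ΔA a2) Σ(k1 ⊗ a4 := coact b1)
    Σ(k2 ⊗ a5 := coact b2) Σ(k3 ⊗ k4 := Δ k2)
    Σ(h1 ⊗ h2 := Δ h) Σ(h3 ⊗ h4 := Δ h2)
    (α a1 ⊗ β ((k1 · β k3) · β h1)) ⊗
      ((α⁻¹ a4 ⊗ (β k4 · β h3)) ⊗ (α⁻¹ a5 ⊗ h4))).
    telim (ΔA a) => a1 a2; telim (ΔA a2) => b1 b2.
    telim (coact b1) => k1 a4; symmetry.
    tcoassoc (coact_coassoc comoduleA b2) (coact b2) (comul DH) coact => k2 k3 a5.
    by rewrite !monomialE.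
  (* Coassociativity of [ΔA] and of [Δ] moves both splittings from the right leg to the left one. *)
  transitivity (Σ(a1 ⊗ a2 := ΔA a) Σ(a3 ⊗ a4 := ΔA a1) Σ(k1 ⊗ a5 := coact a4)
    Σ(k2 ⊗ a6 := coact a2) Σ(k3 ⊗ k4 := Δ k2)
    Σ(h1 ⊗ h2 := Δ h) Σ(h3 ⊗ h4 := Δ h1)
    (a3 ⊗ (k1 · β (k3 · β h3))) ⊗
      ((α⁻¹ a5 ⊗ (k4 · β h4)) ⊗ (a6 ⊗ β h2))).
    symmetry.
    tcoassoc (comul_coassoc coalgA a) (ΔA a) (comul DA) (comul DA) => a1 a2 a3.
    rewrite (coact_aut comoduleA).
    telim (coact a2) => k1 a5; telim (coact a3) => k2 a6.
    rewrite (comul_aut coalgH); telim (Δ k2) => k3 k4.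
    tcoassoc (comul_coassoc coalgH h) (Δ h) (comul DH) (comul DH) => h1 h2 h3.
    by rewrite !monomialE.
  telim (ΔA a) => a1 a2; telim (coact a2) => k2 a6; telim (Δ h) => h1 h2.
  rewrite biproduct_comulE (comul_mul bH) autH_inv (comul_aut coalgH).
  telim (ΔA a1) => a3 a4; telim (coact a4) => k1 a5.
  telim (Δ k2) => k3 k4; telim (Δ h1) => h3 h4.
  by rewrite tens_autE !monomialE.
- move=> x; telim x => a h; rewrite biproduct_comulE tens_autE.
  transitivity (Σ(h1 ⊗ h2 := Δ h) Σ(a1 ⊗ a2 := ΔA a) Σ(k ⊗ a3 := coact a2)
     (εA a1 * (ε k * ε h1) : K) *: (α⁻¹ a3 ⊗ h2)).
    telim (Δ h) => h1 h2; telim (ΔA a) => a1 a2; telim (coact a2) => k a3.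
    by rewrite biproduct_counitE (counit_mul bH) autH_inv (counit_aut coalgH).
  (* The legs [h1], [a1] and [k] are contracted in turn by the counit axioms of [H], of [A] and of
     the coaction. *)
  rewrite (tsum_counitl (counit_comul coalgH h) (G := fun h2 =>
    Σ(a1 ⊗ a2 := ΔA a) Σ(k ⊗ a3 := coact a2) (εA a1 * ε k : K) *: (α⁻¹ a3 ⊗ h2))).
  + rewrite (tsum_counitl (counit_comul coalgA a) (G := fun a2 =>
      Σ(k ⊗ a3 := coact a2) (ε k : K) *: (α⁻¹ a3 ⊗ β h))).
    * rewrite (tsum_counitl (counit_coact comoduleA (α a)) (G := fun a3 =>
        α⁻¹ a3 ⊗ β h)) ?aut_mapK //; by linears.
    * by linears.
    * by move=> a1 a2; telim (coact a2) => k a3; rewrite scalerA.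
  + by linears.
  + move=> h1 h2; telim (ΔA a) => a1 a2; telim (coact a2) => k a3.
    by rewrite scalerA mulrA mulrC.
- move=> x; telim x => a h; rewrite biproduct_comulE tens_autE.
  transitivity (Σ(h1 ⊗ h2 := Δ h) Σ(a1 ⊗ a2 := ΔA a) Σ(k ⊗ a3 := coact a2)
     (εA a3 * ε h2 : K) *: (a1 ⊗ (k · β h1))).
    telim (Δ h) => h1 h2; telim (ΔA a) => a1 a2; telim (coact a2) => k a3.
    by rewrite biproduct_counitE autH_inv counitA_inv.
  rewrite (tsum_counitr (comul_counit coalgH h) (G := fun h1 =>
    Σ(a1 ⊗ a2 := ΔA a) Σ(k ⊗ a3 := coact a2) (εA a3 : K) *: (a1 ⊗ (k · β h1)))).
  + rewrite (tsum_counitr (comul_counit coalgA a) (G := fun a1 => a1 ⊗ β h)) //;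
      first by linears.
    move=> a1 a2.
    (* The contracted coaction is [εA a2] times the unit of [H], which leaves [εA] available to
       contract [ΔA a]. *)
    rewrite (tsum_counitr (coact_counit comodA a2)
      (G := fun k => a1 ⊗ (k · β (β h)))) //; last by linears.
    by rewrite tpureZl linearZ tpureZr !monomialE.
  + by linears.
  + move=> h1 h2; telim (ΔA a) => a1 a2; telim (coact a2) => k a3.
    by rewrite scalerA mulrC.
Qed.

(* Regroups [(h11, h12), (h21, h22)] as [h1, (h211, h212), h22]; the powers of [β]
   come from Hom-coassociativity and [β² = id]. *)
Lemma comul4 (V : lmodType K) (M : {linear H ⨂ H -> V}) h :
  Σ(h1 ⊗ h2 := Δ h) Σ(h3 ⊗ h4 := Δ h1) Σ(h5 ⊗ h6 := Δ h2)
    h3 ⊗ M (h4 ⊗ h5) ⊗ h6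
  = Σ(h1 ⊗ h2 := Δ h) Σ(k1 ⊗ k2 := Δ h2) β h1 ⊗ M (Δ (β k1)) ⊗ k2.
Proof.
transitivity (Σ(h1 ⊗ h2 := Δ h) Σ(k1 ⊗ k2 := Δ h2) Σ(k3 ⊗ k4 := Δ k2)
  β h1 ⊗ M (k1 ⊗ β k3) ⊗ β k4).
  tcoassoc (comul_coassoc coalgH h) (Δ h) (comul DH) (comul DH) => x y z.
  by rewrite (comul_aut coalgH); telim (Δ z) => z1 z2; rewrite !monomialE.
transitivity (Σ(h1 ⊗ h2 := Δ h) Σ(k1 ⊗ k2 := Δ h2) Σ(k3 ⊗ k4 := Δ k1)
  β h1 ⊗ M (β k3 ⊗ β k4) ⊗ k2).
  telim (Δ h) => h1 h2; symmetry.
  tcoassoc (comul_coassoc coalgH h2) (Δ h2) (comul DH) (comul DH) => x y z.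
  by rewrite !monomialE.
telim (Δ h) => h1 h2; telim (Δ h2) => k1 k2; rewrite (comul_aut coalgH).
by telim (Δ k1) => k3 k4.
Qed.

(** * The braided product, and the Yetter-Drinfeld exchange of the middle legs *)

Lemma braided_productE a b :
  tmap (mul DA) (mul DA)
    (tmid (yd_braiding DH (yd_of DA act coact) (yd_of DA act coact))
       (tmap ΔA ΔA (a ⊗ b)))
  = Σ(a1 ⊗ a2 := ΔA a) Σ(b1 ⊗ b2 := ΔA b) Σ(k ⊗ a0 := coact a2)
    (a1 ∘ (k ▷ α⁻¹ b1)) ⊗ (α⁻¹ a0 ∘ b2).
Proof.
have braidE c d : yd_braiding DH (yd_of DA act coact) (yd_of DA act coact) (c ⊗ d)
    = Σ(k ⊗ a0 := coact c) (β (β k) ▷ α⁻¹ d) ⊗ α⁻¹ a0.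
  by rewrite /= tsumE //; bilinear.
have -> : tmap ΔA ΔA (a ⊗ b) = ΔA a ⊗ ΔA b by exact: tmapE.
telim (ΔA a) => a1 a2; telim (ΔA b) => b1 b2; rewrite tmidE braidE.
by telim (coact a2) => k a0; rewrite tmapE aut2.
Qed.

(** The part of the comultiplied product where [h] meets a coaction: [h4] and [h5] are the middle
    legs of the four-fold coproduct, and [h3] and [h6] are carried along as outer tensor factors. *)
Definition comul_coact_act h c : (H ⨂ (H ⨂ A)) ⨂ H :=
  Σ(h1 ⊗ h2 := Δ h) Σ(h3 ⊗ h4 := Δ h1) Σ(h5 ⊗ h6 := Δ h2)
    Σ(m ⊗ c0 := coact (h4 ▷ c)) h3 ⊗ ((m · h5) ⊗ c0) ⊗ h6.

(** The compatibility concerns two legs of a single coproduct, so it is encoded by linear maps [M]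
    and [N] on [H ⨂ H] that agree on every [Δ g]. [comul4] brings the middle legs into this form,
    and is read backwards once [M] has become [N]. *)
Lemma comul_coact_actE h c : yd_module DH (yd_of DA act coact) ->
  comul_coact_act h c = Σ(h1 ⊗ h2 := Δ h) Σ(h3 ⊗ h4 := Δ h1) Σ(h5 ⊗ h6 := Δ h2)
    Σ(m ⊗ c0 := coact c) h3 ⊗ ((h4 · β m) ⊗ (β h5 ▷ c0)) ⊗ h6.
Proof.
move=> ydA.
have [M ME] : exists M : {linear H ⨂ H -> H ⨂ A}, forall g k,
    M (g ⊗ k) = Σ(m ⊗ c0 := coact (g ▷ c)) (m · k) ⊗ c0.
  have lM : linear (fun t : H ⨂ H =>
    Σ(g ⊗ k := t) Σ(m ⊗ c0 := coact (g ▷ c)) (m · k) ⊗ c0) by linears.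
  by exists (lin_of lM) => g k /=; tsimp.
have [N NE] : exists N : {linear H ⨂ H -> H ⨂ A}, forall g k,
    N (g ⊗ k) = Σ(m ⊗ c0 := coact c) (g · β m) ⊗ (β k ▷ c0).
  have lN : linear (fun t : H ⨂ H =>
    Σ(g ⊗ k := t) Σ(m ⊗ c0 := coact c) (g · β m) ⊗ (β k ▷ c0)) by linears.
  by exists (lin_of lN) => g k /=; tsimp.
have MN g : M (Δ g) = N (Δ g).
  transitivity (Σ(h1 ⊗ h2 := Δ g) Σ(k ⊗ n := coact (β (β h1) ▷ c)) (k · h2) ⊗ n).
    by telim (Δ g) => h1 h2; rewrite ME aut2.
  rewrite -(yd_compat ydA) /=.
  telim (Δ g) => h1 h2; rewrite NE.
  by telim (coact c) => k n; rewrite aut2.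
transitivity (Σ(h1 ⊗ h2 := Δ h) Σ(h3 ⊗ h4 := Δ h1) Σ(h5 ⊗ h6 := Δ h2)
    h3 ⊗ M (h4 ⊗ h5) ⊗ h6).
  rewrite /comul_coact_act.
  telim (Δ h) => h1 h2; telim (Δ h1) => h3 h4; telim (Δ h2) => h5 h6.
  by rewrite ME; telim (coact (h4 ▷ c)) => m c0.
rewrite comul4; transitivity (Σ(h1 ⊗ h2 := Δ h) Σ(k1 ⊗ k2 := Δ h2)
    β h1 ⊗ N (Δ (β k1)) ⊗ k2).
  by telim (Δ h) => h1 h2; telim (Δ h2) => k1 k2; rewrite MN.
rewrite -comul4; telim (Δ h) => h1 h2; telim (Δ h1) => h3 h4; telim (Δ h2) => h5 h6.
by rewrite NE; telim (coact c) => m c0.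
Qed.

(** * From Yetter-Drinfeld bialgebras to biproducts *)

Section FromYD.
Hypothesis ydA : yd_bialgebra DH DA act coact.

Lemma coact_mulA_of_yd a b : coact (a ∘ b)
  = Σ(h ⊗ a0 := coact a) Σ(k ⊗ b0 := coact b) (h · k) ⊗ (a0 ∘ b0).
Proof.
have /= -> := yd_morphism_coact (yd_bialgebra_mul ydA) (a ⊗ b).
tsimp; telim (coact a) => h a0; telim (coact b) => k b0.
by rewrite !monomialE.
Qed.

Lemma comulA_act_of_yd h a : ΔA (h ▷ a)
  = Σ(a1 ⊗ a2 := ΔA a) Σ(h1 ⊗ h2 := Δ h) (h1 ▷ a1) ⊗ (h2 ▷ a2).
Proof.
have /= -> := yd_morphism_act (yd_bialgebra_comul ydA) h a.
by rewrite tsumE //; bilinear.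
Qed.

Lemma counitA_act_of_yd h a : εA (h ▷ a) = ε h * εA a.
Proof.
have /= -> := yd_morphism_act (yd_bialgebra_counit ydA) h a.
by rewrite tsumE //; bilinear.
Qed.

Lemma comulA_mul_of_yd a b : ΔA (a ∘ b)
  = Σ(a1 ⊗ a2 := ΔA a) Σ(b1 ⊗ b2 := ΔA b) Σ(k ⊗ a0 := coact a2)
    (a1 ∘ (k ▷ α⁻¹ b1)) ⊗ (α⁻¹ a0 ∘ b2).
Proof. by rewrite (yd_comul_mul ydA) braided_productE. Qed.

Lemma coactA_one_of_yd : coact 1A = 1H ⊗ 1A.
Proof.
have /= := yd_morphism_coact (yd_bialgebra_one ydA) 1.
by rewrite tsumE ?scale1r //; bilinear.
Qed.

(** The conditions in the Yetter-Drinfeld category expand the left side around [comul_coact_act],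
    which [comul_coact_actE] rewrites. What then separates the two sides is a double coaction on
    [a2] against a coproduct of its [H]-leg. *)
Lemma biproduct_comul_mul_of_yd x y : comul B (mul B (x ⊗ y))
  = Σ(x1 ⊗ x2 := comul B x) Σ(y1 ⊗ y2 := comul B y)
    mul B (x1 ⊗ y1) ⊗ mul B (x2 ⊗ y2).
Proof.
telim x => a h; telim y => b k.
rewrite biproduct_mulE !biproduct_comulE.
transitivity (Σ(b1 ⊗ b2 := ΔA b) Σ(a1 ⊗ a2 := ΔA a) Σ(k1 ⊗ k2 := Δ k)
  Σ(l ⊗ a3 := coact a2) Σ(m ⊗ a4 := coact a3)
  Σ(t ⊗ h6 := comul_coact_act h (α⁻¹ b2)) Σ(h3 ⊗ s := t) Σ(n ⊗ b3 := s)
    ((a1 ∘ (l ▷ α⁻¹ (h3 ▷ α⁻¹ b1))) ⊗ (m · (β n · β k1)))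
    ⊗ (α⁻¹ (α⁻¹ a4 ∘ b3) ⊗ (β h6 · k2))).
  rewrite /comul_coact_act; telim (Δ h) => h1 h2.
  rewrite biproduct_comulE comulA_mul_of_yd comulA_act_of_yd comulA_inv (comul_mul bH).
  rewrite autH_inv (comul_aut coalgH).
  telim (ΔA b) => b1 b2; telim (ΔA a) => a1 a2; telim (Δ k) => k1 k2.
  telim (coact a2) => l a3; telim (Δ h1) => h3 h4; rewrite coact_mulA_of_yd coact_inv.
  telim (coact a3) => m a4; telim (Δ h2) => h5 h6.
  telim (coact (h4 ▷ α⁻¹ b2)) => n b3.
  by rewrite !monomialE.
telim (ΔA b) => b1 b2; rewrite comul_coact_actE ?coact_inv;
  last exact: yd_bialgebra_object ydA.
telim (ΔA a) => a1 a2; telim (Δ h) => h1 h2; telim (Δ k) => k1 k2.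
telim (coact b2) => n b3.
(* On the right side the product comultiplies the [H]-leg [l · β h1] of the first factor, whence
   [Δ l]. *)
transitivity (Σ(l ⊗ a3 := coact a2) Σ(l1 ⊗ l2 := Δ l)
  Σ(h3 ⊗ h4 := Δ h1) Σ(h5 ⊗ h6 := Δ h2)
  ((a1 ∘ ((l1 · β h3) ▷ α⁻¹ b1)) ⊗ (β (l2 · β h4) · (n · β k1)))
  ⊗ ((α⁻¹ a3 ∘ (h5 ▷ α⁻¹ (α⁻¹ b3))) ⊗ (β h6 · k2))).
  symmetry.
  tcoassoc (coact_coassoc comoduleA a2) (coact a2) (comul DH) coact => l m a3.
  telim (Δ h1) => h3 h4; telim (Δ h2) => h5 h6.
  by rewrite !monomialE.
telim (coact a2) => l a3.
rewrite !biproduct_mulE (comul_mul bH) !autH_inv (comul_aut coalgH).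
telim (Δ l) => l1 l2; telim (Δ h1) => h3 h4; telim (Δ h2) => h5 h6.
by rewrite !monomialE.
Qed.

Lemma biproduct_of_yd : hom_bialgebra B.
Proof.
split.
- exact: biproduct_algebra.
- exact: biproduct_coalgebra.
- exact: biproduct_comul_mul_of_yd.
- rewrite biproduct_comulE (yd_comul_one ydA); tsimp; rewrite coactA_one_of_yd; tsimp.
  by rewrite (comul_one bH); tsimp; rewrite !monomialE.
- move=> x y.
  telim x => a h; telim y => b k.
  rewrite biproduct_mulE !biproduct_counitE.
  transitivity (Σ(h1 ⊗ h2 := Δ h) (εA a * (ε h1 * εA b)) * (ε h2 * ε k)).
    telim (Δ h) => h1 h2; rewrite biproduct_counitE (counit_mul bH) autH_inv.
    by rewrite (yd_counit_mul ydA) counitA_act_of_yd counitA_inv (counit_aut coalgH).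
  rewrite (tsum_counitl (counit_comul coalgH h)
    (G := fun h2 => (εA a * εA b) * (ε h2 * ε k))).
  + by rewrite (counit_aut coalgH) mulrACA.
  + by linears.
  + move=> h1 h2; rewrite -[RHS]/(ε h1 * ((εA a * εA b) * (ε h2 * ε k))).
    by rewrite [RHS]mulrA; congr (_ * _); exact: mulrCA.
- transitivity (εA 1A * ε 1H); first exact: biproduct_counitE.
  by rewrite (yd_counit_one ydA) (counit_one bH) mulr1.
Qed.

End FromYD.

(** * From biproducts to Yetter-Drinfeld bialgebras *)

Fact projA_linear : linear (fun x : A ⨂ H => Σ(a ⊗ h := x) (ε h : K) *: a).
Proof. by linears. Qed.
Definition projA : {linear A ⨂ H -> A} := lin_of projA_linear.

Fact projH_linear : linear (fun x : A ⨂ H => Σ(a ⊗ h := x) (εA a : K) *: h).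
Proof. by linears. Qed.
Definition projH : {linear A ⨂ H -> H} := lin_of projH_linear.

Lemma projAE a h : projA (a ⊗ h) = (ε h : K) *: a.
Proof. by rewrite /= tsumE //; bilinear. Qed.

Lemma projHE a h : projH (a ⊗ h) = (εA a : K) *: h.
Proof. by rewrite /= tsumE //; bilinear. Qed.

(** [ε] is multiplicative, so it contracts [k] and [h1] separately; the counit axiom of the coaction
    then cancels the [α⁻¹] in the comultiplication of [B]. *)
Lemma projAA_comul a h : tmap projA projA (comul B (a ⊗ h)) = (ε h : K) *: ΔA a.
Proof.
rewrite biproduct_comulE.
transitivity (Σ(h1 ⊗ h2 := Δ h) Σ(a1 ⊗ a2 := ΔA a) Σ(k ⊗ a3 := coact a2)
  (ε h1 * ε h2 : K) *: ((ε k : K) *: (a1 ⊗ α⁻¹ a3))).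
  telim (Δ h) => h1 h2; telim (ΔA a) => a1 a2; telim (coact a2) => k a3.
  rewrite tmapE !projAE (counit_mul bH) autH_inv (counit_aut coalgH).
  by rewrite tpureZl tpureZr !scalerA -mulrA mulrC.
rewrite (tsum_counitl (counit_comul coalgH h) (G := fun h2 => (ε h2 : K) *:
   Σ(a1 ⊗ a2 := ΔA a) Σ(k ⊗ a3 := coact a2) ((ε k : K) *: (a1 ⊗ α⁻¹ a3)))).
- rewrite (counit_aut coalgH); congr (_ *: _).
  transitivity (Σ(a1 ⊗ a2 := ΔA a) a1 ⊗ a2); last by telim (ΔA a).
  telim (ΔA a) => a1 a2.
  rewrite (tsum_counitl (counit_coact comoduleA a2) (G := fun a3 => a1 ⊗ α⁻¹ a3)) //;
    last by linears.
  by rewrite aut_mapK.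
- by linears.
- by move=> h1 h2; telim (ΔA a) => a1 a2; telim (coact a2) => k a3; rewrite !scalerA ?mulrA.
Qed.

(** Here [εA] removes [a1] and [ε] removes [h2], so that only the coaction survives; at [h = 1H] it
    is recovered exactly. *)
Lemma projHA_comul a h : tmap projH projA (comul B (a ⊗ h))
  = Σ(k ⊗ a0 := coact a) (β k · h) ⊗ a0.
Proof.
rewrite biproduct_comulE.
transitivity (Σ(h1 ⊗ h2 := Δ h) Σ(a1 ⊗ a2 := ΔA a) Σ(k ⊗ a3 := coact a2)
  (ε h2 : K) *: ((εA a1 : K) *: ((k · β h1) ⊗ α⁻¹ a3))).
  telim (Δ h) => h1 h2; telim (ΔA a) => a1 a2; telim (coact a2) => k a3.
  by rewrite tmapE projAE projHE autH_inv tpureZl tpureZr !scalerA mulrC.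
rewrite (tsum_counitr (comul_counit coalgH h) (G := fun h1 =>
   Σ(a1 ⊗ a2 := ΔA a) Σ(k ⊗ a3 := coact a2) (εA a1 : K) *: ((k · β h1) ⊗ α⁻¹ a3))).
- rewrite (tsum_counitl (counit_comul coalgA a) (G := fun a2 =>
     Σ(k ⊗ a3 := coact a2) (k · β (β h)) ⊗ α⁻¹ a3)).
  + rewrite (coact_aut comoduleA); telim (coact a) => k a0.
    by rewrite aut2 aut_mapK.
  + by linears.
  + by move=> a1 a2; telim (coact a2).
- by linears.
- by move=> h1 h2; telim (ΔA a) => a1 a2; telim (coact a2).
Qed.

(** [ε] contracts the second leg of [h], but the first leg still acts: this is the source of the
    actions in the conditions extracted below. *)
Lemma projA_mul a h y : projA (mul B ((a ⊗ h) ⊗ y)) = a ∘ (β h ▷ α⁻¹ (projA y)).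
Proof.
telim y => b k; rewrite biproduct_mulE.
transitivity (Σ(h1 ⊗ h2 := Δ h) (ε h2 * ε k : K) *: (a ∘ (h1 ▷ α⁻¹ b))).
  telim (Δ h) => h1 h2; rewrite projAE (counit_mul bH) autH_inv.
  by rewrite (counit_aut coalgH).
rewrite (tsum_counitr (comul_counit coalgH h)
  (G := fun h1 => (ε k : K) *: (a ∘ (h1 ▷ α⁻¹ b)))).
- by rewrite projAE linearZ tpureZr linearZ tpureZr linearZ.
- by linears.
- by move=> h1 h2; rewrite scalerA.
Qed.

Section ToYD.
Hypothesis bB : hom_bialgebra B.

Lemma counitA_one_of_biproduct : εA 1A = 1.
Proof.
have := counit_one bB.
have -> : counit B (one B) = εA 1A * ε 1H by exact: biproduct_counitE.
by rewrite (counit_one bH) mulr1.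
Qed.

Lemma biproduct_mul_a1 a b : mul B ((a ⊗ 1H) ⊗ (b ⊗ 1H)) = (a ∘ b) ⊗ 1H.
Proof. by rewrite biproduct_mulE (comul_one bH); tsimp; rewrite !monomialE. Qed.

Lemma biproduct_mul_1h h a : mul B ((1A ⊗ h) ⊗ (a ⊗ 1H))
  = Σ(h1 ⊗ h2 := Δ h) (β h1 ▷ a) ⊗ h2.
Proof. by rewrite biproduct_mulE; telim (Δ h) => h1 h2; rewrite !monomialE. Qed.

Lemma counitA_mul_of_biproduct a b : εA (a ∘ b) = εA a * εA b.
Proof.
have := counit_mul bB (a ⊗ 1H) (b ⊗ 1H).
by rewrite biproduct_mul_a1 !biproduct_counitE (counit_one bH) !mulr1.
Qed.

Lemma counitA_act_of_biproduct h a : εA (h ▷ a) = ε h * εA a.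
Proof.
have := counit_mul bB (1A ⊗ h) (a ⊗ 1H).
rewrite biproduct_mul_1h !biproduct_counitE counitA_one_of_biproduct (counit_one bH).
rewrite mul1r mulr1 => <-; symmetry.
transitivity (Σ(h1 ⊗ h2 := Δ h) ε h2 * εA (β h1 ▷ a)).
  by telim (Δ h) => h1 h2; rewrite biproduct_counitE mulrC.
rewrite (tsum_counitr (comul_counit coalgH h) (G := fun h1 => εA (β h1 ▷ a))) //.
  by rewrite aut2.
by linears.
Qed.

(** Multiplicativity and linearity of [εA] over [H] remove the action, so [projH] respects
    products. *)
Lemma projH_mul x y : projH (mul B (x ⊗ y)) = projH x · projH y.
Proof.
telim x => a h; telim y => b k; rewrite biproduct_mulE.
transitivity (Σ(h1 ⊗ h2 := Δ h) (ε h1 * (εA a * εA b) : K) *: (β h2 · k)).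
  telim (Δ h) => h1 h2; rewrite projHE counitA_mul_of_biproduct.
  by rewrite counitA_act_of_biproduct autH_inv counitA_inv mulrCA.
rewrite (tsum_counitl (counit_comul coalgH h)
  (G := fun h2 => (εA a * εA b : K) *: (β h2 · k))).
- by rewrite !projHE aut2 tpureZl tpureZr 2!linearZ /= scalerA.
- by linears.
- by move=> h1 h2; rewrite scalerA.
Qed.

Lemma comulA_one_of_biproduct : ΔA 1A = 1A ⊗ 1A.
Proof.
have := projAA_comul 1A 1H; rewrite (counit_one bH) scale1r => <-.
have -> : comul B (1A ⊗ 1H) = (1A ⊗ 1H) ⊗ (1A ⊗ 1H) by exact: comul_one bB.
by rewrite tmapE projAE (counit_one bH) scale1r.
Qed.

Lemma coactA_one_of_biproduct : coact 1A = 1H ⊗ 1A.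
Proof.
transitivity (tmap projH projA (comul B (1A ⊗ 1H))).
  rewrite projHA_comul; transitivity (Σ(k ⊗ a0 := coact 1A) k ⊗ a0).
    by telim (coact 1A).
  by telim (coact 1A) => k a0; rewrite !monomialE.
have -> : comul B (1A ⊗ 1H) = (1A ⊗ 1H) ⊗ (1A ⊗ 1H) by exact: comul_one bB.
by rewrite tmapE projAE projHE (counit_one bH) counitA_one_of_biproduct !scale1r.
Qed.

Lemma biproduct_comul_1h h : comul B (1A ⊗ h)
  = Σ(h1 ⊗ h2 := Δ h) (1A ⊗ h1) ⊗ (1A ⊗ h2).
Proof.
rewrite biproduct_comulE comulA_one_of_biproduct; tsimp; rewrite coactA_one_of_biproduct; tsimp.
by telim (Δ h) => h1 h2; rewrite !monomialE.
Qed.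

Lemma biproduct_comul_a1 a : comul B (a ⊗ 1H)
  = Σ(a1 ⊗ a2 := ΔA a) Σ(k ⊗ a3 := coact a2) (a1 ⊗ β k) ⊗ (α⁻¹ a3 ⊗ 1H).
Proof.
rewrite biproduct_comulE (comul_one bH).
by telim (ΔA a) => a1 a2; telim (coact a2) => k a3; rewrite !monomialE.
Qed.

Lemma projAA_comul_a1 a : tmap projA projA (comul B (a ⊗ 1H)) = ΔA a.
Proof. by rewrite projAA_comul (counit_one bH) scale1r. Qed.

Lemma projHA_comul_a1 a : tmap projH projA (comul B (a ⊗ 1H)) = coact a.
Proof.
rewrite projHA_comul; transitivity (Σ(k ⊗ a0 := coact a) k ⊗ a0).
  by telim (coact a) => k a0; rewrite !monomialE.
by telim (coact a).
Qed.

Lemma comulA_act_of_biproduct h a : ΔA (h ▷ a)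
  = Σ(h1 ⊗ h2 := Δ h) Σ(a1 ⊗ a2 := ΔA a) (h1 ▷ a1) ⊗ (h2 ▷ a2).
Proof.
transitivity (tmap projA projA (comul B (mul B ((1A ⊗ h) ⊗ (a ⊗ 1H))))).
  rewrite biproduct_mul_1h; symmetry.
  transitivity (Σ(h1 ⊗ h2 := Δ h) (ε h2 : K) *: ΔA (β h1 ▷ a)).
    by telim (Δ h) => h1 h2; rewrite projAA_comul.
  rewrite (tsum_counitr (comul_counit coalgH h) (G := fun h1 => ΔA (β h1 ▷ a))) //.
    by rewrite aut2.
  by linears.
(* [ΔA a] is written as a projection so that both sides become linear in [comul B (a ⊗ 1H)], which
   need not be expanded. *)
rewrite (comul_mul bB) biproduct_comul_1h -(projAA_comul_a1 a).
telim (Δ h) => h1 h2; telim (comul B (a ⊗ 1H)) => y1 y2.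
by rewrite !tmapE; tsimp; rewrite !projA_mul !monomialE.
Qed.

(** The Yetter-Drinfeld compatibility with the twists that the projections produce;
    [yd_compat_of_biproduct] converts them. *)
Lemma biproduct_yd_compat h a :
  Σ(h1 ⊗ h2 := Δ h) Σ(k ⊗ a0 := coact (β h1 ▷ a)) (β k · h2) ⊗ a0
  = Σ(h1 ⊗ h2 := Δ h) Σ(k ⊗ a0 := coact a) (h1 · k) ⊗ (h2 ▷ a0).
Proof.
transitivity (tmap projH projA (comul B (mul B ((1A ⊗ h) ⊗ (a ⊗ 1H))))).
  by rewrite biproduct_mul_1h; telim (Δ h) => h1 h2; rewrite projHA_comul.
rewrite (comul_mul bB) biproduct_comul_1h -(projHA_comul_a1 a).
telim (Δ h) => h1 h2; telim (comul B (a ⊗ 1H)) => y1 y2.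
rewrite !tmapE; tsimp; rewrite projA_mul projH_mul projHE.
by rewrite counitA_one_of_biproduct scale1r !monomialE.
Qed.

Lemma comulA_mul_of_biproduct a b : ΔA (a ∘ b)
  = Σ(a1 ⊗ a2 := ΔA a) Σ(b1 ⊗ b2 := ΔA b) Σ(k ⊗ a0 := coact a2)
    (a1 ∘ (k ▷ α⁻¹ b1)) ⊗ (α⁻¹ a0 ∘ b2).
Proof.
rewrite -(projAA_comul_a1 (a ∘ b)) -biproduct_mul_a1 (comul_mul bB).
rewrite (biproduct_comul_a1 a) -(projAA_comul_a1 b).
telim (ΔA a) => a1 a2; telim (comul B (b ⊗ 1H)) => y1 y2.
rewrite tmapE; tsimp; telim (coact a2) => k a3.
by rewrite tmapE !projA_mul !monomialE.
Qed.

Lemma coact_mulA_of_biproduct a b : coact (a ∘ b)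
  = Σ(h ⊗ a0 := coact a) Σ(k ⊗ b0 := coact b) (h · k) ⊗ (a0 ∘ b0).
Proof.
rewrite -(projHA_comul_a1 (a ∘ b)) -biproduct_mul_a1 (comul_mul bB).
rewrite -(projHA_comul_a1 b).
telim (comul B (b ⊗ 1H)) => y1 y2.
rewrite tmapE biproduct_comul_a1; tsimp.
(* [a1] enters only through [εA], so the counit axiom of [A] collapses [ΔA a]. *)
transitivity (Σ(a1 ⊗ a2 := ΔA a) Σ(k ⊗ a3 := coact a2)
    (εA a1 : K) *: ((β k · projH y1) ⊗ (α⁻¹ a3 ∘ projA y2))).
  telim (ΔA a) => a1 a2; telim (coact a2) => k a3.
  by rewrite tmapE projH_mul projHE projA_mul tpureZl linearZ tpureZl !monomialE.
rewrite (tsum_counitl (counit_comul coalgA a) (G := fun a2 =>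
   Σ(k ⊗ a3 := coact a2) (β k · projH y1) ⊗ (α⁻¹ a3 ∘ projA y2))).
- by rewrite (coact_aut comoduleA); telim (coact a) => k a0; rewrite !monomialE.
- by linears.
- by move=> a1 a2; telim (coact a2).
Qed.

Lemma yd_compat_of_biproduct h m :
  Σ(h1 ⊗ h2 := Δ h) Σ(k ⊗ n := coact m) (h1 · β k) ⊗ (β (β (β h2)) ▷ n)
  = Σ(h1 ⊗ h2 := Δ h) Σ(k ⊗ n := coact (β (β h1) ▷ m)) (k · h2) ⊗ n.
Proof.
(* The untwisted identity is used at [α m], followed by [α⁻¹] on the [A]-leg: this supplies the
   missing powers of [β]. *)
transitivity (Σ(k ⊗ n := Σ(h1 ⊗ h2 := Δ h) Σ(k ⊗ n := coact (α m))
   (h1 · k) ⊗ (h2 ▷ n)) k ⊗ α⁻¹ n).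
  rewrite (coact_aut comoduleA).
  by telim (Δ h) => h1 h2; telim (coact m) => k n; rewrite !monomialE.
rewrite -biproduct_yd_compat; telim (Δ h) => h1 h2.
rewrite -(aut_act moduleA) (coact_aut comoduleA) aut2.
by telim (coact (h1 ▷ m)) => k n; rewrite !monomialE.
Qed.

(** This colinearity of [ΔA] is the comodule coalgebra axiom itself, as [β²] and [β⁻²] are both the
    identity. *)
Lemma coact_comul_tensor a :
  Σ(a1 ⊗ a2 := ΔA a) Σ(h ⊗ d1 := coact a1) Σ(k ⊗ d2 := coact a2)
    β⁻¹ (β⁻¹ (h · k)) ⊗ (d1 ⊗ d2)
  = Σ(h ⊗ d := coact a) h ⊗ ΔA d.
Proof.
transitivity (Σ(h ⊗ d := coact a) Σ(d1 ⊗ d2 := ΔA d) β (β h) ⊗ (d1 ⊗ d2)).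
  rewrite (coact_comul comodA).
  telim (ΔA a) => a1 a2; telim (coact a1) => h d1; telim (coact a2) => k d2.
  by rewrite !monomialE.
telim (coact a) => h d; rewrite aut2.
by telim (ΔA d).
Qed.

(** Linearity of the product and unit and colinearity of [ΔA] and [εA] come from the module algebra
    and comodule coalgebra axioms; the complementary conditions come from the biproduct. *)
Lemma yd_of_biproduct : yd_bialgebra DH DA act coact.
Proof.
split.
- by split; [exact: moduleA | exact: comoduleA | exact: yd_compat_of_biproduct].
- split.
  + move=> h x /=; telim x => a b; rewrite act_mul2.
    by telim (Δ h) => h1 h2.
  + move=> x; telim x => a b /=; tsimp; rewrite coact_mulA_of_biproduct.
    by telim (coact a) => h a0; telim (coact b) => k b0; rewrite !monomialE.
  + move=> x; telim x => a b; rewrite tens_autE; exact: (aut_mul algA).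
- split.
  + move=> h k /=; rewrite tsumE; last by bilinear.
    by rewrite tpureZr linearZ /= (act_one modA) scalerA mulrC.
  + move=> k /=; rewrite tsumE; last by bilinear.
    by rewrite linearZ /= coactA_one_of_biproduct tpureZr.
  + by move=> k /=; rewrite linearZ /= (aut_one algA).
- split.
  + move=> h a; rewrite comulA_act_of_biproduct.
    transitivity (Σ(a1 ⊗ a2 := ΔA a) Σ(h1 ⊗ h2 := Δ h) (h1 ▷ a1) ⊗ (h2 ▷ a2)).
      by telim (ΔA a) => a1 a2; telim (Δ h) => h1 h2.
    by rewrite /= tsumE //; bilinear.
  + exact: coact_comul_tensor.
  + by move=> a /=; rewrite (comul_aut coalgA).
- split.
  + move=> h a /=; rewrite counitA_act_of_biproduct tsumE //; bilinear.
  + move=> a; symmetry.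
    transitivity (Σ(h ⊗ d := coact a) (εA d : K) *: (h ⊗ (1 : K^o))).
      rewrite /=; telim (coact a) => h d.
      by rewrite -tpureZr; congr (_ ⊗ _); rewrite /GRing.scale /= mulr1.
    rewrite (tsum_counitr (coact_counit comodA a) (G := fun h => h ⊗ (1 : K^o))) //.
      by rewrite tpureZl -tpureZr; congr (_ ⊗ _); rewrite /GRing.scale /= mulr1.
    by linears.
  + by move=> a /=; rewrite (counit_aut coalgA).
- by move=> x; telim x => a b; rewrite braided_productE comulA_mul_of_biproduct.
- exact: comulA_one_of_biproduct.
- exact: counitA_mul_of_biproduct.
- exact: counitA_one_of_biproduct.
Qed.

End ToYD.
End Radford.

Theorem theorem4p8 (K : fieldType)
    (H : lmodType K) (DH : hom_data H) (S : {linear H -> H})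
    (hopfH : hom_hopf DH S) (bijS : bijective S)
    (aut2 : forall h : H, aut DH (aut DH h) = h)
    (A : lmodType K) (DA : hom_data A)
    (act : {linear H ⨂ A -> A}) (coact : {linear A -> H ⨂ A})
    (modA : module_hom_algebra DH DA act)
    (comodA : comodule_hom_coalgebra DH DA coact) :
  hom_bialgebra (biproduct DH DA act coact) <-> yd_bialgebra DH DA act coact.
Proof.
have bH := hom_hopf_bialgebra hopfH.
split; [exact: yd_of_biproduct | exact: biproduct_of_yd].
Qed.
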